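(* Let $\Gamma$ be a finite connected graph without loops, with a Hamiltonian $\mathcal H$ and associated Lagrangian $\mathcal L$. Let $c\in H^1(\Gamma,\mathbb R)$ and let $\omega\in C^1(\Gamma,\mathbb R)$ have cohomology class $c$. Then: (i) $\widetilde\alpha(c)=\alpha(c)$, where $\widetilde\alpha(c)$ is the critical value of $\mathcal H^\omega$ and $\alpha$ is Mather's $\alpha$-function; (ii) if an irreducible measure belongs to $\mathbb M_c$, then it is supported on a circuit $\zeta$ such that $\sigma^\omega(\zeta,\alpha(c))=0$; (iii) if $\zeta=(e_i)_{i=1}^N$ is a circuit such that $\sigma^\omega(\zeta,\alpha(c))=0$ and $\mathcal Q_c(e_i)\ne0$ for all $i=1,\dots,N$, then there exists an irreducible Mather measure supported on a parametrization of $\zeta$.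
   Context: Graph. $\Gamma=(V,E)$ consists of disjoint finite sets $V$ (vertices) and $E\neq\emptyset$ (directed edges), a map $o:E\to V$ (origin) and a fixed-point-free involution $e\mapsto -e$ of $E$; $t(e):=o(-e)$. A path is a finite sequence of edges $(e_i)_{i=1}^M$ with $t(e_i)=o(e_{i+1})$; it is closed (a cycle) if $o(e_1)=t(e_M)$; a circuit is a cycle with $t(e_i)=t(e_j)\Rightarrow i=j$. $\Gamma$ is connected and has no loops ($o(e)\ne t(e)$). (Co)homology. $C_0$ is the real vector space with basis $V$; $C_1$ is the real vector space generated by $E$ with the edge $-e$ identified with the opposite of $e$; $\partial e=t(e)-o(e)$; $H_1(\Gamma,\mathbb R)=\ker\partial\subset C_1$. $C^0$ = functions $V\to\mathbb R$; $C^1$ = functions $\omega:E\to\mathbb R$ with $\omega(-e)=-\omega(e)$; $dg(e)=g(t(e))-g(o(e))$; $H^1(\Gamma,\mathbb R)=C^1/dC^0$. The pairing $\langle\omega,e\rangle=\omega(e)$ extends linearly to $C^1\times C_1$ and descends to $H^1\times H_1$. Tangent bundle and measures. $T\Gamma=(E\times[0,+\infty))/\sim$, where $(e,0)\sim(-e,0)$; $\mathbb R^+_e:=\{e\}\times[0,+\infty)$. The metric is $d((e_1,q_1),(e_2,q_2))=q_1+q_2+1$ if $e_1\ne\pm e_2$, $|q_1-q_2|$ if $e_1=e_2$, $q_1+q_2$ if $e_1=-e_2$. $\mathbb P$ is the set of Borel probability measures on $T\Gamma$ with $\int q\,d\mu<+\infty$. For $\mu\in\mathbb P$, $\rho(\mu)=\sum_{e\in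 E}\big(\int_{\mathbb R^+_e}q\,d\mu\big)e\in C_1$ and, for $\omega\in C^1$, $\int\omega\,d\mu:=\langle\omega,\rho(\mu)\rangle$. $\mu$ is closed if $\int df\,d\mu=0$ for all $f\in C^0$, equivalently $\rho(\mu)\in H_1(\Gamma,\mathbb R)$; $\mathbb M\subset\mathbb P$ is the (convex) set of closed measures. A closed measure is irreducible if it is extremal in $\mathbb M$, i.e. not of the form $(1-\lambda)\mu_1+\lambda\mu_2$ with $\mu_1\ne\mu_2$ in $\mathbb M$, $\lambda\in(0,1)$. Parametrized paths. A parametrized path is $\xi=(e_i,q_i,T_i)_{i=1}^M$ such that: $(e_i)_{i=1}^M$ is a path (its support); $q_i\ge0$, $T_i=1/q_i$ if $q_i>0$, and $T_i$ is an arbitrary positive constant if $q_i=0$; if all $q_i$ vanish then $o(e_1)=t(e_M)$; if $q_i=0$ and $e_{i+1}\ne-e_i$ then $q_{i+1}\neq0$; if $q_i\ne0$ and $i>1$, then $o(e_i)=t(e_j)$ with $j=\max\{k<i:q_k\ne0\}$ (and $o(e_i)=o(e_1)$ if there is no such $k$). It is called a parametrized circuit if its support is a circuit. Its occupation measure is $\mu_\xi=\frac1{T_\xi}\sum_iT_i\,\delta(e_i,q_i)$, $T_\xi=\sum_iT_i$. A measure is supported on (a parametrization of) a circuit $\zeta$ if it is the occupation measure of a parametrized circuit with support $\zeta$. Hamiltonian and Lagrangian. A Hamiltonian is a family $\mathcal H(e,\cdot):\mathbb R\to\mathbb R$, $e\in E$, with $\mathcal H(e,p)=\mathcal H(-e,-p)$,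 each strictly convex, differentiable and superlinear ($\mathcal H(e,p)/|p|\to+\infty$ as $p\to\pm\infty$). $p_e$ is the minimizer of $\mathcal H(e,\cdot)$, $a_e=\mathcal H(e,p_e)=a_{-e}$, and $\sigma(e,\cdot):[a_e,+\infty)\to[p_e,+\infty)$ is the inverse of $\mathcal H(e,\cdot)$ restricted to $[p_e,+\infty)$. $\mathcal L(e,q)=\max_p(pq-\mathcal H(e,p))$, well defined on $T\Gamma$. For $\omega\in C^1$: $\mathcal H^\omega(e,p)=\mathcal H(e,p+\omega(e))$, $\mathcal L^\omega(e,q)=\mathcal L(e,q)-q\,\omega(e)$, $\sigma^\omega(e,a)=\sigma(e,a)-\omega(e)$. For a path $\xi=(e_i)_{i=1}^M$ and $a\ge\max_ea_e$, $\sigma^\omega(\xi,a)=\sum_i\sigma^\omega(e_i,a)$. Mather theory. $\beta(h)=\min\{\int\mathcal L\,d\mu:\mu\in\mathbb M,\rho(\mu)=h\}$; $\alpha(c)=\max_h(\langle c,h\rangle-\beta(h))=-\min_{\mu\in\mathbb M}\int\mathcal L^\omega d\mu$ for any representative $\omega$ of $c$. $\mathbb M_c$ is the set of $\mu\in\mathbb M$ with $\int\mathcal L^\omega d\mu=-\alpha(c)$ (Mather measures with cohomology $c$); a Mather measure is an element of $\mathbb M_{c'}$ for some $c'$. Weak KAM objects. A function $u:V\to\mathbb R$ is a subsolution at level $a$ if $\max_{e:\,t(e)=x}\mathcal H^\omega(e,du(e))\le a$ for every $x\in V$. The critical value $\widetilde\alpha(c)$ of $\mathcal H^\omega$ is the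 minimum of the $a\in\mathbb R$ for which subsolutions at level $a$ exist; it depends only on $c$ and is $\ge\max_ea_e$. The Aubry set $\mathcal A_c\subset E$ is the set of edges belonging to some cycle $\xi$ with $\sigma^\omega(\xi,\widetilde\alpha(c))=0$. For $e\in\mathcal A_c$, $\mathcal Q_c(e):=\frac{\partial}{\partial p}\mathcal H^\omega(e,du(e))$, where $u$ is any subsolution at level $\widetilde\alpha(c)$; this value is independent of $u$ and of the representative $\omega$ of $c$ (indeed $du(e)=\sigma^\omega(e,\widetilde\alpha(c))$ on $\mathcal A_c$), and is nonnegative. *)

(* Defs.v *)
From HB Require Import structures.
From mathcomp Require Import all_boot all_order all_algebra.
From mathcomp Require Import generic_quotient ring_quotient.
From mathcomp Require Import all_classical all_reals all_analysis.
From mathcomp Require Import lra.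

Set Implicit Arguments.
Unset Strict Implicit.
Unset Printing Implicit Defensive.
Import Order.TTheory GRing.Theory Num.Theory.
Import numFieldNormedType.Exports.

Local Open Scope classical_set_scope.
Local Open Scope ring_scope.
Local Open Scope quotient_scope.

Record graph := Graph {
  vertex : finType;
  edge : finType;
  orig : edge -> vertex;
  rev_edge : edge -> edge;
  rev_edgeK : involutive rev_edge;
  rev_edge_neq : forall e, rev_edge e != e;
  edge_card_gt0 : (0 < #|edge|)%N
}.

Section Paths.
Variable G : graph.

Definition term (e : edge G) : vertex G := orig (rev_edge e).

Definition connected_graph : Prop :=
  forall x y : vertex G,
    connect [rel a b | [exists e : edge G, (orig e == a) && (term e == b)]] x y.

Definition loopless : Prop := forall e : edge G, orig e <> term e.

Definition consecutive : rel (edge G) := [rel e f | term e == orig f].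

Definition is_path (s : seq (edge G)) : bool := sorted consecutive s.

(* The library's [cycle] is the wrap-around condition, true of [::]. *)
Definition is_cycle (s : seq (edge G)) : bool :=
  (s != [::]) && cycle consecutive s.

Definition is_circuit (s : seq (edge G)) : bool :=
  is_cycle s && uniq (map term s).

End Paths.

Section Cohomology.
Variables (R : realType) (G : graph).

Definition cochain0 := {ffun vertex G -> R}.

Definition antisymmetric_edge (w : {ffun edge G -> R}) : bool :=
  [forall e, w (rev_edge e) == - w e].

Lemma antisymmetric_edge_zmod : zmod_closed antisymmetric_edge.
Proof.
split; first by apply/forallP => e; rewrite !ffunE oppr0.
move=> u v /forallP hu /forallP hv; apply/forallP => e.
by rewrite !ffunE (eqP (hu e)) (eqP (hv e)) opprD.
Qed.

HB.instance Definition _ :=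
  GRing.isZmodClosed.Build {ffun edge G -> R} antisymmetric_edge
    antisymmetric_edge_zmod.

Record cochain1 := Cochain1 {
  cochain1_val :> {ffun edge G -> R};
  cochain1P : antisymmetric_edge cochain1_val
}.

HB.instance Definition _ := [isSub for cochain1_val].
HB.instance Definition _ := [Choice of cochain1 by <:].
HB.instance Definition _ := [SubChoice_isSubZmodule of cochain1 by <:].

Lemma coboundary_subproof (g : cochain0) :
  antisymmetric_edge [ffun e : edge G => g (term e) - g (orig e)].
Proof.
by apply/forallP => e; rewrite !ffunE /term rev_edgeK opprB.
Qed.

Definition coboundary (g : cochain0) : cochain1 :=
  Cochain1 (coboundary_subproof g).

Definition exact_cochain (w : cochain1) : bool :=
  `[< exists g : cochain0, w = coboundary g >].

Lemma exact_cochain_zmod : zmod_closed exact_cochain.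
Proof.
split.
  apply/asboolP; exists 0; apply/val_inj/ffunP => e /=.
  by rewrite !ffunE subr0.
move=> u v /asboolP[f ->] /asboolP[g ->]; apply/asboolP; exists (f - g).
by apply/val_inj/ffunP => e /=; rewrite !ffunE; lra.
Qed.

HB.instance Definition _ :=
  GRing.isZmodClosed.Build cochain1 exact_cochain exact_cochain_zmod.

Definition cohomology1 :=
  Quotient.quot (GRing.ZmodClosed.clone cochain1 exact_cochain _).

(* The formal combination \sum_e (w e) e vanishes once -e is identified with
   the opposite of e iff w lies in the span of the vectors e + (-e), that is,
   iff w is invariant under edge reversal. *)
Definition null_combination (w : {ffun edge G -> R}) : bool :=
  [forall e, w (rev_edge e) == w e].

Lemma null_combination_zmod : zmod_closed null_combination.
Proof.
split; first by apply/forallP => e; rewrite !ffunE.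
move=> u v /forallP hu /forallP hv; apply/forallP => e.
by rewrite !ffunE (eqP (hu e)) (eqP (hv e)).
Qed.

HB.instance Definition _ :=
  GRing.isZmodClosed.Build {ffun edge G -> R} null_combination
    null_combination_zmod.

Definition chain1 :=
  Quotient.quot (GRing.ZmodClosed.clone {ffun edge G -> R} null_combination _).

Definition boundary (h : chain1) : {ffun vertex G -> R} :=
  [ffun x => \sum_(e : edge G)
               (repr h) e * ((term e == x)%:R - (orig e == x)%:R)].

Definition homology1 : set chain1 := [set h | boundary h = 0].

Definition pairing (w : cochain1) (h : chain1) : R :=
  \sum_(e : edge G) (repr h) e * w e.

(* Independent of the representative of c when h is in homology1. *)
Definition class_pairing (c : cohomology1) (h : chain1) : R :=
  pairing (repr c) h.

End Cohomology.

Section TangentBundle.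
Variables (R : realType) (G : graph).

Definition ray_point := (edge G * {nonneg R})%type.

Definition zero_glue (a b : ray_point) : bool :=
  (a == b) || [&& a.2%:num == 0, b.2%:num == 0 & a.1 == rev_edge b.1].

Lemma zero_glue_refl : reflexive zero_glue.
Proof. by move=> a; rewrite /zero_glue eqxx. Qed.

Lemma zero_glue_sym : symmetric zero_glue.
Proof.
move=> a b; rewrite /zero_glue eq_sym; congr (_ || _).
rewrite andbCA; do 2 congr (_ && _).
by apply/eqP/eqP => ->; rewrite rev_edgeK.
Qed.

Lemma zero_glue_trans : transitive zero_glue.
Proof.
move=> b a c /predU1P[-> //|/and3P[/eqP a0 /eqP b0 /eqP ab]].
case/predU1P => [<-|/and3P[_ /eqP c0 /eqP bc]].
  by rewrite /zero_glue a0 b0 ab !eqxx orbT.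
apply/orP; left; apply/eqP; case: a c a0 c0 ab bc {b0} => [e q] [f r] /= q0 r0.
move=> -> ->; rewrite rev_edgeK; congr pair.
by apply/val_inj; rewrite /= q0 r0.
Qed.

Canonical zero_glue_equiv :=
  EquivRel zero_glue zero_glue_refl zero_glue_sym zero_glue_trans.

Definition tangent := {eq_quot zero_glue}.

HB.instance Definition _ := Choice.on tangent.
HB.instance Definition _ := EqQuotient.on tangent.

Definition tpoint (e : edge G) (q : {nonneg R}) : tangent := \pi_tangent (e, q).

Definition speed (x : tangent) : R := (repr x).2%:num.

Definition ray_dist (a b : ray_point) : R :=
  if a.1 == b.1 then `|a.2%:num - b.2%:num|
  else if a.1 == rev_edge b.1 then a.2%:num + b.2%:num
  else a.2%:num + b.2%:num + 1.

Definition tangent_dist (x y : tangent) : R := ray_dist (repr x) (repr y).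

Lemma ray_dist_sym a b : ray_dist a b = ray_dist b a.
Proof.
rewrite /ray_dist eq_sym distrC; case: ifP => // _.
have -> : (a.1 == rev_edge b.1) = (b.1 == rev_edge a.1).
  by apply/eqP/eqP => ->; rewrite rev_edgeK.
by rewrite (addrC a.2%:num).
Qed.

Lemma ray_dist_eq0 a b : ray_dist a b = 0 -> zero_glue a b.
Proof.
case: a b => [e q] [f r]; rewrite /ray_dist /zero_glue /=.
have q0 : 0 <= q%:num by [].
have r0 : 0 <= r%:num by [].
case: eqVneq => [<- /eqP|_].
  rewrite normr_eq0 subr_eq0 => /eqP qr.
  by apply/orP; left; apply/eqP; congr pair; apply/val_inj.
case: eqVneq => [_ qr|_ qr]; last by lra.
have -> : q%:num = 0 by lra.
have -> : r%:num = 0 by lra.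
by rewrite eqxx orbT.
Qed.

Lemma ray_dist_triangle b a c : ray_dist a c <= ray_dist a b + ray_dist b c.
Proof.
case: a b c => [e q] [f r] [g s]; rewrite /ray_dist /=.
have q0 : 0 <= q%:num by [].
have r0 : 0 <= r%:num by [].
have s0 : 0 <= s%:num by [].
move: q%:num r%:num s%:num q0 r0 s0 => {q r s} q r s q0 r0 s0.
have revI x y : (x == rev_edge y) = (rev_edge x == y :> edge G).
  by apply/eqP/eqP => [->|<-]; rewrite rev_edgeK.
have abs1 (x y : R) : 0 <= x -> 0 <= y -> `|x - y| <= x + y.
  by move=> x0 y0; rewrite ler_norml; apply/andP; split; lra.
have abs2 (x y : R) : x - y <= `|x - y| by exact: ler_norm.
have abs3 (x y : R) : y - x <= `|x - y| by rewrite distrC; exact: ler_norm.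
have abs4 (x y z : R) : `|x - z| <= `|x - y| + `|y - z| by exact: ler_distD.
have := abs1 q s q0 s0; have := abs2 q r; have := abs3 q r.
have := abs2 r s; have := abs3 r s; have := abs4 q r s.
case: (eqVneq e f) => [->|ef].
  case: (eqVneq f g) => [//|fg] *.
  by case: ifP => _; lra.
case: (eqVneq f g) => [<-|fg].
  by rewrite (negPf ef); case: ifP => _ *; lra.
case: (eqVneq e (rev_edge f)) => [->|erf].
  case: (eqVneq f (rev_edge g)) => [->|frg]; first by rewrite rev_edgeK eqxx => *; lra.
  have -> : (rev_edge f == g) = false by rewrite -revI (negPf frg).
  by rewrite (inj_eq (can_inj (@rev_edgeK G))) (negPf fg) => *; lra.
by case: (f == rev_edge g); case: (e == g); case: (e == rev_edge g) => *; lra.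
Qed.

Lemma tangent_distxx x : tangent_dist x x = 0.
Proof. by rewrite /tangent_dist /ray_dist eqxx subrr normr0. Qed.

Lemma tangent_dist_positivity x y : tangent_dist x y = 0 -> x = y.
Proof.
move=> /ray_dist_eq0 xy; rewrite -(reprK x) -(reprK y).
by apply/eqquotP.
Qed.

Lemma tangent_dist_sym x y : tangent_dist x y = tangent_dist y x.
Proof. exact: ray_dist_sym. Qed.

Lemma tangent_dist_triangle y x z :
  tangent_dist x z <= tangent_dist x y + tangent_dist y z.
Proof. exact: ray_dist_triangle. Qed.

HB.instance Definition _ := isMetric.Build R tangent tangent_distxx
  tangent_dist_positivity tangent_dist_sym tangent_dist_triangle.

HB.instance Definition _ := isPointed.Build tangent
  (tpoint (enum_val (Ordinal (edge_card_gt0 G))) 0%:nng).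

Definition borel_tangent := g_sigma_algebraType (@open tangent).

Definition ray (e : edge G) : set borel_tangent := range (tpoint e).

End TangentBundle.

Section Measures.
Variables (R : realType) (G : graph).

Definition borel_probability := probability (borel_tangent R G) R.

Definition finite_first_moment (mu : borel_probability) : Prop :=
  (\int[mu]_x (speed x)%:E < +oo)%E.

Definition rho (mu : borel_probability) : chain1 R G :=
  \pi_(chain1 R G)
    ([ffun e : edge G => (\int[mu]_(x in ray e) speed x)%R]
       : {ffun edge G -> R}).

Definition integral_form (w : cochain1 R G) (mu : borel_probability) : R :=
  pairing w (rho mu).

Definition closed_measure (mu : borel_probability) : Prop :=
  finite_first_moment mu /\
  forall f : cochain0 R G, integral_form (coboundary f) mu = 0.

(* Library measures are functions on all sets, so equality of Borel measures
   is equality on the measurable sets. *)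
Definition same_measure (mu nu : borel_probability) : Prop :=
  forall A, measurable A -> mu A = nu A.

Definition irreducible_measure (mu : borel_probability) : Prop :=
  closed_measure mu /\
  ~ exists mu1 mu2 : borel_probability, exists l : R,
      [/\ closed_measure mu1, closed_measure mu2, ~ same_measure mu1 mu2,
          0 < l < 1
        & forall A, measurable A ->
            mu A = ((1 - l)%:E * mu1 A + l%:E * mu2 A)%E].

End Measures.

Section ParametrizedPaths.
Variables (R : realType) (G : graph) (M : nat).
Variables (e : M.-tuple (edge G)) (q : 'I_M -> {nonneg R}) (T : 'I_M -> R).

(* In the last clause j is the last index before i with nonzero speed. *)
Definition parametrized_path : Prop :=
  [/\ is_path e,
      forall i, 0 < T i /\ ((q i)%:num != 0 -> T i = 1 / (q i)%:num),
      (forall i, (q i)%:num = 0) ->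
        forall i j : 'I_M, i = 0%N :> nat -> j = M.-1 :> nat ->
          orig (tnth e i) = term (tnth e j),
      forall i j : 'I_M, j = i.+1 :> nat -> (q i)%:num = 0 ->
        tnth e j != rev_edge (tnth e i) -> (q j)%:num != 0
    & forall i : 'I_M, (0 < i)%N -> (q i)%:num != 0 ->
        (forall j : 'I_M, (j < i)%N -> (q j)%:num != 0 ->
           (forall k : 'I_M, (j < k < i)%N -> (q k)%:num = 0) ->
           orig (tnth e i) = term (tnth e j)) /\
        ((forall k : 'I_M, (k < i)%N -> (q k)%:num = 0) ->
           forall j : 'I_M, j = 0%N :> nat ->
           orig (tnth e i) = orig (tnth e j))].

Definition total_time : R := \sum_i T i.

Definition occupation_measure (A : set (borel_tangent R G)) : \bar R :=
  ((total_time^-1)%:E *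
   \sum_i ((T i)%:E * \d_(tpoint (tnth e i) (q i) : borel_tangent R G) A))%E.

End ParametrizedPaths.

Definition supported_on (R : realType) (G : graph) (M : nat)
    (z : M.-tuple (edge G)) (mu : borel_probability R G) : Prop :=
  is_circuit z /\
  exists (q : 'I_M -> {nonneg R}) (T : 'I_M -> R),
    parametrized_path z q T /\
    forall A, measurable A -> mu A = occupation_measure z q T A.

Section Hamiltonians.
Variables (R : realType) (G : graph).

Record hamiltonian (H : edge G -> R -> R) : Prop := {
  hamiltonian_rev : forall e p, H e p = H (rev_edge e) (- p);
  hamiltonian_strictly_convex : forall e (x y t : R),
    x != y -> 0 < t < 1 ->
    H e ((1 - t) * x + t * y) < (1 - t) * H e x + t * H e y;
  hamiltonian_derivable : forall e (p : R), derivable (H e) p 1;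
  hamiltonian_superlinear_pinfty : forall e,
    H e p / `|p| @[p --> +oo%R] --> +oo%R;
  hamiltonian_superlinear_ninfty : forall e,
    H e p / `|p| @[p --> -oo%R] --> +oo%R
}.

Variable H : edge G -> R -> R.

Definition twist (w : cochain1 R G) : edge G -> R -> R :=
  fun e p => H e (p + w e).

Definition minimizer (e : edge G) : R :=
  xget 0 [set p | forall p', H e p <= H e p'].

Definition min_level (e : edge G) : R := H e (minimizer e).

(* Only meaningful for min_level e <= a. *)
Definition sigma (e : edge G) (a : R) : R :=
  xget (minimizer e) [set p | minimizer e <= p /\ H e p = a].

Definition sigma_path (w : cochain1 R G) (s : seq (edge G)) (a : R) : R :=
  \sum_(e <- s) (sigma e a - w e).

(* The supremum is attained. *)
Definition lagrangian_edge (e : edge G) (q : R) : R :=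
  sup [set p * q - H e p | p in [set: R]].

Definition lagrangian (x : tangent R G) : R :=
  lagrangian_edge (repr x).1 (speed x).

Definition twisted_lagrangian (w : cochain1 R G) (x : tangent R G) : R :=
  lagrangian x - speed x * w (repr x).1.

Definition action (mu : borel_probability R G) : \bar R :=
  (\int[mu]_x (lagrangian x)%:E)%E.

Definition twisted_action (w : cochain1 R G) (mu : borel_probability R G) :
  \bar R := (\int[mu]_x (twisted_lagrangian w x)%:E)%E.

(* Only measures of finite action enter. This infimum is attained, and so are
   the supremum in alpha and the infimum in critical_value. *)
Definition beta (h : chain1 R G) : R :=
  inf [set b : R | exists mu, [/\ closed_measure mu, rho mu = h
                                & action mu = b%:E]].

Definition alpha (c : cohomology1 R G) : R :=
  sup [set class_pairing c h - beta h | h in @homology1 R G].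

Definition mather_measures (c : cohomology1 R G) :
    set (borel_probability R G) :=
  [set mu | closed_measure mu /\
     forall w : cochain1 R G, \pi_(cohomology1 R G) w = c ->
       twisted_action w mu = (- alpha c)%:E].

Definition subsolution (K : edge G -> R -> R) (a : R) (u : cochain0 R G) :
    Prop :=
  forall (x : vertex G) (e : edge G), term e = x -> K e (coboundary u e) <= a.

Definition critical_value (K : edge G -> R -> R) : R :=
  inf [set a | exists u, subsolution K a u].

(* None of the following depends on the choice of representative of c. *)
Definition class_critical_value (c : cohomology1 R G) : R :=
  critical_value (twist (repr c)).

Definition aubry_set (c : cohomology1 R G) : set (edge G) :=
  [set e | exists s, [/\ is_cycle s, e \in s
    & sigma_path (repr c) s (class_critical_value c) = 0]].

Definition critical_subsolution (c : cohomology1 R G) : cochain0 R G :=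
  xget 0 [set u | subsolution (twist (repr c)) (class_critical_value c) u].

(* Only meaningful on the Aubry set, where it does not depend on the critical
   subsolution; set to 0 elsewhere. *)
Definition aubry_speed (c : cohomology1 R G) (e : edge G) : R :=
  if `[< aubry_set c e >] then
    derive1 (twist (repr c) e) (coboundary (critical_subsolution c) e)
  else 0.

End Hamiltonians.

(* Main.v *)
(* Adding to omega the differential of a critical subsolution u gives a
   representative v of c with H(e, v e) <= a on every edge, a the critical
   value, and Fenchel's inequality makes L^v + a nonnegative; hence
   alpha(c) <= a. Call an edge tight if H(e, v e) = a and give it the speed
   H'(e, v e). If no tight edge has speed zero and the tight edges of positive
   speed contain no circuit, then x |-> (number of vertices reachable from x
   along them) decreases on each of them, so moving u in its direction gives a
   subsolution at a lower level. Hence there is either a tight edge at rest or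
   a tight circuit, and the corresponding occupation measure has v-action -a,
   so alpha(c) = a.
   A Mather measure is carried by the zeros of L^v + a, which are finitely many
   points, one per tight edge. It thus carries a finite circulation, which
   dominates a multiple of some circuit (or of a point at rest);
   irreducibility makes it equal to the normalized circuit measure. Conversely
   a circulation supported in a circuit is constant, so circuit measures are
   irreducible. *)
Require Import Defs.
From HB Require Import structures.
From mathcomp Require Import all_boot all_order all_algebra.
From mathcomp Require Import generic_quotient ring_quotient.
From mathcomp Require Import all_classical all_reals all_analysis.
From mathcomp Require Import measurable_realfun ring lra.

Set Implicit Arguments.
Unset Strict Implicit.
Unset Printing Implicit Defensive.
Import Order.TTheory GRing.Theory Num.Theory.
Import numFieldNormedType.Exports.

Local Open Scope classical_set_scope.
Local Open Scope ring_scope.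
Local Open Scope quotient_scope.

(** * Strictly convex superlinear functions *)

Section ConvexReal.
Variables (R : realType) (h : R -> R).
Hypothesis hconv : forall x y t : R, x != y -> 0 < t < 1 ->
  h ((1 - t) * x + t * y) < (1 - t) * h x + t * h y.
Hypothesis hder : forall p : R, derivable h p 1.

Lemma derivable1_Rcontinuous : continuous h.
Proof. by move=> x; apply/differentiable_continuous/derivable1_diffP/hder. Qed.

(** The sign of [d] lets one right-hand limit cover both directions of motion: differentiability
    makes the directional derivative linear in [d]. *)
Lemma cvg_slope_right (x d : R) :
  t^-1 * (h (t * d + x) - h x) @[t --> 0^'+] --> derive1 h x * d.
Proof.
have dx : differentiable h x by apply/derivable1_diffP/hder.
have dd : derivable h x d by exact: diff_derivable.
have -> : derive1 h x * d = 'D_d h x.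
  rewrite derive1E !deriveE// -[in RHS](mulr1 d) [_ * 1]/(_ *: 1).
  by rewrite linearZ/= mulrC.
apply: cvg_trans dd; apply: cvg_app => A [e e0 Ae].
by exists e => // t te t0; apply: Ae => //; rewrite gt_eqF.
Qed.

Lemma slope_descent x d : derive1 h x * d < 0 ->
  \forall t \near 0^'+, h (x + t * d) < h x.
Proof.
move=> xd0; have := cvgr_lt _ (@cvg_slope_right x d) _ xd0.
move=> near_lt; near=> t.
have t0 : 0 < t by near: t; exact: nbhs_right_gt.
have : t^-1 * (h (t * d + x) - h x) < 0 by near: t; exact: near_lt.
by rewrite pmulr_rlt0 ?invr_gt0// subr_lt0 addrC.
Unshelve. all: by end_near. Qed.

(** Convexity bounds the difference quotients from [x] towards [y] by [h y - h x]; the bound passes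
    to the limit at 0. *)
Lemma tangent_le x y : h x + derive1 h x * (y - x) <= h y.
Proof.
have [<-|xy] := eqVneq x y; first by rewrite subrr mulr0 addr0.
suff : derive1 h x * (y - x) <= h y - h x by lra.
apply: cvgr_to_le (@cvg_slope_right x (y - x)) _; near=> t.
have t0 : 0 < t by near: t; exact: nbhs_right_gt.
have t1 : t < 1 by near: t; exact: nbhs_right_lt.
have := hconv xy (t := t); rewrite t0 t1 => /(_ isT).
rewrite (_ : (1 - t) * x + t * y = t * (y - x) + x); last by ring.
by move=> hh; rewrite mulrC ler_pdivrMr//; nra.
Unshelve. all: by end_near. Qed.

(** The function [h r - r * q] has a minimum at [p]: equality in Fenchel's inequality determines the
    speed. *)
Lemma derive1_min_slope p q : (forall p', p' * q - h p' <= p * q - h p) ->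
  derive1 h p = q.
Proof.
move=> pmax.
have dx : is_derive p 1 h (derive1 h p) by rewrite derive1E; exact/derivableP.
have dg (z : R) : derivable (fun r => h r - r * q) z 1.
  by apply: derivableB => //; apply: derivableM => //.
have := @derive1_at_min R (fun r => h r - r * q) (p - 1) (p + 1) p _ (fun z _ => dg z) _ _.
move=> /(_ _ _ _)[]; [lra|by rewrite in_itv/=; apply/andP; split; lra|
  by move=> t _; have := pmax t; lra|].
move=> _ D0.
have : 'D_1 (fun r => h r - r * q) p = derive1 h p - q.
  rewrite derive_val /GRing.scale/=; ring.
by rewrite D0; lra.
Qed.

Lemma derive1_min0 m : (forall p, h m <= h p) -> derive1 h m = 0.
Proof.
by move=> hm; apply: derive1_min_slope => p'; rewrite !mulr0 !sub0r lerN2.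
Qed.

Lemma convex_min_unique m p : (forall p, h m <= h p) -> h p <= h m -> p = m.
Proof.
move=> hm pm; apply/eqP/negPn/negP => mp.
(* Two distinct minimizers would have a midpoint of strictly smaller value. *)
have t01 : 0 < (2^-1 : R) < 1 by apply/andP; split; lra.
have := hconv mp t01; by have := hm ((1 - 2^-1) * p + 2^-1 * m); lra.
Qed.

Lemma convex_increasing m x y : (forall p, h m <= h p) -> m <= x -> x < y ->
  h x < h y.
Proof.
move=> hm; rewrite le_eqVlt => /predU1P[<- my|mx xy].
  rewrite lt_neqAle hm andbT; apply/eqP => e.
  by have := convex_min_unique hm (p := y); rewrite e lexx => /(_ isT); lra.
have my : m != y by rewrite lt_eqF//; lra.
have ym : 0 < y - m by lra.
pose t := (x - m) / (y - m).
have t01 : 0 < t < 1.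
  apply/andP; split; first by rewrite divr_gt0//; lra.
  by rewrite ltr_pdivrMr//; lra.
have := hconv my t01.
rewrite (_ : (1 - t) * m + t * y = x); last first.
  by rewrite /t; field; lra.
have := hm y; nra.
Qed.

Lemma derive1_ge0_right m p : (forall p, h m <= h p) -> 0 <= derive1 h p -> m <= p.
Proof.
move=> hm dp; rewrite leNgt; apply/negP => pm.
(* If [p < m], the tangent at [p] shows [h p <= h m], which makes [p] a second minimizer. *)
have := tangent_le p m; have := @convex_min_unique m p hm.
move=> E T; suff /E : h p <= h m by lra.
by nra.
Qed.

Lemma derive1_right_ge0 m p : (forall p, h m <= h p) -> m <= p -> 0 <= derive1 h p.
Proof.
move=> hm; rewrite le_eqVlt => /predU1P[<-|mp].
  by rewrite (derive1_min0 hm).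
by have := tangent_le p m; have := hm p; nra.
Qed.

Hypothesis hpy : h p / `|p| @[p --> +oo%R] --> +oo%R.
Hypothesis hny : h p / `|p| @[p --> -oo%R] --> +oo%R.

(** Outside a compact interval superlinearity gives the bound even with [B = 0]; on the interval [h]
    has a minimum, which [B] absorbs. *)
Lemma superlinear_ge (A : R) : exists B, forall p, A * `|p| - B <= h p.
Proof.
move/cvgryPge: hpy => /(_ A)[a [_ ha]].
move/cvgryPge: hny => /(_ A)[b [_ hb]].
pose K := Num.max 1 (Num.max `|a| `|b|).
have K1 : 1 <= K by rewrite /K le_max lexx.
have Ka : a <= K by rewrite /K !le_max (ler_norm a) orbT.
have Kb : - K <= b.
  have : `|b| <= K by rewrite /K !le_max lexx !orbT.
  by rewrite ler_norml => /andP[].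
have [c _ hc] : exists2 c, c \in `[- K, K]%R & forall t, t \in `[- K, K]%R -> h c <= h t.
  apply: EVT_min; first lra.
  exact/continuous_subspaceT/derivable1_Rcontinuous.
exists (`|A| * K + `|h c|) => p.
have [pK|pK] := leP `|p| K.
  have /hc : p \in `[- K, K]%R by rewrite in_itv/= -ler_norml.
  have := ler_norm (- h c); rewrite normrN.
  have : A * `|p| <= `|A| * K.
    by rewrite (le_trans (ler_norm _))// normrM normr_id ler_wpM2l.
  lra.
suff H : A * `|p| <= h p.
  have : 0 <= `|A| * K by rewrite mulr_ge0//; lra.
  by have := normr_ge0 (h c); lra.
have p0 : 0 < `|p| by lra.
rewrite -ler_pdivlMr//; move: pK; case: (leP 0 p) => pp.
  by rewrite {1}ger0_norm// => pK; apply: ha; lra.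
by rewrite {1}ltr0_norm// => pK; apply: hb; lra.
Qed.

Lemma superlinear_bound (C : R) : exists B, forall p, h p <= C -> `|p| <= B.
Proof.
have [B hB] := superlinear_ge 1; exists (C + B) => p.
by have := hB p; lra.
Qed.

Lemma superlinear_min : exists m, forall p, h m <= h p.
Proof.
have [B hB] := superlinear_bound (h 0).
have B0 : 0 <= B by have := hB 0 (lexx _); rewrite normr0.
have [c _ hc] : exists2 c, c \in `[- B, B]%R & forall t, t \in `[- B, B]%R -> h c <= h t.
  apply: EVT_min; first lra.
  exact/continuous_subspaceT/derivable1_Rcontinuous.
exists c => p; have [/hB|ph] := leP (h p) (h 0).
  by rewrite ler_norml => pB; apply: hc; rewrite in_itv.
apply: le_trans (ltW ph); apply: hc; rewrite in_itv/=; lra.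
Qed.

Lemma superlinear_level m C : (forall p, h m <= h p) -> h m <= C ->
  exists2 p, m <= p & h p = C.
Proof.
move=> hm mC; have [B hB] := superlinear_bound C.
(* Beyond the bound [B] of the sublevel set, so that [C < h y]. *)
pose y := Num.max m (B + 1).
have my : m <= y by rewrite /y le_max lexx.
have Cy : C < h y.
  rewrite ltNge; apply/negP => /hB; have : B + 1 <= y by rewrite /y le_max lexx orbT.
  by have := ler_norm y; lra.
have [] := @IVT R h m y C my.
- exact/continuous_subspaceT/derivable1_Rcontinuous.
- by rewrite ge_min mC/= le_max (ltW Cy) orbT.
- by move=> p; rewrite in_itv/= => /andP[mp _] hp; exists p.
Qed.

End ConvexReal.

(** * Hamiltonian and Lagrangian on an edge *)

Section EdgeHamiltonian.
Variables (R : realType) (G : graph) (H : edge G -> R -> R).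
Hypothesis HH : hamiltonian H.
Implicit Types (e : edge G) (p q a : R).

Let Hconv e := @hamiltonian_strictly_convex _ _ _ HH e.
Let Hder e (p : R) : derivable (H e) p 1 := @hamiltonian_derivable _ _ _ HH e p.

Lemma hamiltonian_continuous e : continuous (H e).
Proof. by move=> x; apply: derivable1_Rcontinuous. Qed.

Lemma hamiltonian_tangent_le e p p' :
  H e p + derive1 (H e) p * (p' - p) <= H e p'.
Proof. exact: tangent_le (@Hconv e) (@Hder e) _ _. Qed.

Lemma hamiltonian_descent e p d : derive1 (H e) p * d < 0 ->
  \forall t \near 0^'+, H e (p + t * d) < H e p.
Proof. exact: slope_descent (@Hder e) _ _. Qed.

Lemma hamiltonian_bound e a : exists B, forall p, H e p <= a -> `|p| <= B.
Proof.
exact: superlinear_bound (@Hder e) (hamiltonian_superlinear_pinfty HH e)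
  (hamiltonian_superlinear_ninfty HH e) a.
Qed.

Lemma minimizer_le e p : H e (minimizer H e) <= H e p.
Proof.
have [m hm] := superlinear_min (@Hder e) (hamiltonian_superlinear_pinfty HH e)
  (hamiltonian_superlinear_ninfty HH e).
exact: (@xgetI _ 0 [set p | forall p', H e p <= H e p'] m hm).
Qed.

(** The tangent line of [H e] at [p], reflected, supports [H (rev_edge e)] at [- p], and a
    supporting slope is the derivative. *)
Lemma derive1_rev e p : derive1 (H (rev_edge e)) (- p) = - derive1 (H e) p.
Proof.
apply: derive1_min_slope => // p'; rewrite !(hamiltonian_rev HH (rev_edge e)).
by rewrite rev_edgeK opprK; have := hamiltonian_tangent_le e p (- p'); nra.
Qed.

Lemma derive1_twist (w : cochain1 R G) e p :
  derive1 (twist H w e) p = derive1 (H e) (p + w e).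
Proof.
by rewrite /derive1 /twist; under eq_fun do rewrite -addrA.
Qed.

Lemma sigma_spec e a : min_level H e <= a ->
  minimizer H e <= sigma H e a /\ H e (sigma H e a) = a.
Proof.
move=> ma; have [p mp hp] := superlinear_level (@Hder e)
  (hamiltonian_superlinear_pinfty HH e) (hamiltonian_superlinear_ninfty HH e)
  (minimizer_le e) ma.
exact: (@xgetI _ (minimizer H e) [set p | minimizer H e <= p /\ H e p = a] p).
Qed.

Lemma le_sigma e p a : H e p <= a -> p <= sigma H e a.
Proof.
move=> pa; have [ms hs] := sigma_spec (le_trans (minimizer_le e p) pa).
rewrite leNgt; apply/negP => sp.
have := convex_increasing (@Hconv e) (minimizer_le e) ms sp; lra.
Qed.

Lemma derive1_sigma_ge0 e a : min_level H e <= a ->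
  0 <= derive1 (H e) (sigma H e a).
Proof.
move=> /sigma_spec[ms _].
have := derive1_right_ge0 (@Hconv e) (@Hder e) (minimizer_le e) ms; exact.
Qed.

(** A nonnegative derivative puts [p] on the increasing branch of [H e], where a level is reached
    only once. *)
Lemma sigma_eq e p : 0 <= derive1 (H e) p -> sigma H e (H e p) = p.
Proof.
move=> dp; have mp := derive1_ge0_right (@Hconv e) (@Hder e) (minimizer_le e) dp.
have [ms hs] := sigma_spec (minimizer_le e p).
have inc := convex_increasing (@Hconv e) (minimizer_le e).
by case: (ltgtP (sigma H e (H e p)) p) => // /inc => /(_ ltac:(lra)); lra.
Qed.

Let has_sup_legendre e q : has_sup [set p * q - H e p | p in [set: R]].
Proof.
split; first by exists (0 * q - H e 0), 0.
have [B hB] := superlinear_ge (@Hder e) (hamiltonian_superlinear_pinfty HH e)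
  (hamiltonian_superlinear_ninfty HH e) `|q|.
exists B => _ [p _ <-]; have := hB p.
by have := ler_norm (p * q); rewrite normrM mulrC; lra.
Qed.

Lemma fenchel_le e p q : p * q - H e p <= lagrangian_edge H e q.
Proof. by apply: sup_upper_bound => //; exists p. Qed.

Lemma lagrangian_edge_le e q b : (forall p, p * q - H e p <= b) ->
  lagrangian_edge H e q <= b.
Proof.
move=> hb; apply: ge_sup; first by case: (has_sup_legendre e q).
by move=> _ [p _ <-].
Qed.

(** For [q] the derivative at [p], the tangent inequality says that [p] maximizes
    [p' * q - H e p']. *)
Lemma lagrangian_edge_derive1 e p :
  lagrangian_edge H e (derive1 (H e) p) = p * derive1 (H e) p - H e p.
Proof.
apply/le_anti/andP; split; last exact: fenchel_le.
by apply: lagrangian_edge_le => p'; have := hamiltonian_tangent_le e p p'; nra.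
Qed.

Lemma fenchel_eq e p q : lagrangian_edge H e q <= p * q - H e p ->
  derive1 (H e) p = q.
Proof.
move=> pq; apply: derive1_min_slope => // p'.
exact: le_trans (fenchel_le e p' q) pq.
Qed.

(** Compatibility with the gluing of [e] and [rev_edge e] at speed 0, through the symmetry of the
    Hamiltonian. *)
Lemma lagrangian_edge0 e : lagrangian_edge H e 0 = lagrangian_edge H (rev_edge e) 0.
Proof.
have aux f : lagrangian_edge H f 0 <= lagrangian_edge H (rev_edge f) 0.
  apply: lagrangian_edge_le => p; rewrite mulr0 (hamiltonian_rev HH).
  by have := fenchel_le (rev_edge f) (- p) 0; rewrite mulr0.
by apply/le_anti; rewrite aux/= -{2}[e]rev_edgeK aux.
Qed.

(** As a supremum of affine functions of [q], the Lagrangian is lower semicontinuous: the set where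
    it exceeds [r] is a union of open sets. *)
Lemma measurable_lagrangian_edge e :
  measurable_fun setT (lagrangian_edge H e).
Proof.
apply: (measurability _ (RGenOInfty.measurableE R)) => /= _ [_ [r ->] <-].
rewrite setTI; apply: open_measurable.
rewrite (_ : _ @^-1` _ = \bigcup_(p in [set: R]) [set q | r < p * q - H e p]).
  apply: bigcup_open => p _.
  rewrite (_ : [set q | _] = (fun q => p * q - H e p) @^-1` [set x | r < x])//.
  apply: open_comp => [q _|]; last exact: open_gt.
  by apply: cvgB; [apply: cvgM; [exact: cvg_cst|exact: cvg_id]|exact: cvg_cst].
apply/seteqP; split => q /=; rewrite in_itv/= andbT.
  by case/(sup_gt (has_sup_legendre e q).1) => _ [p _ <-] rp; exists p.
by move=> [p _] /lt_le_trans; apply; exact: fenchel_le.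
Qed.

End EdgeHamiltonian.

(** * The tangent bundle *)

Section TangentPoints.
Variables (R : realType) (G : graph).
Implicit Types (e f : edge G) (q r : {nonneg R}) (x y : tangent R G).

Lemma tpoint_repr x : tpoint (repr x).1 (repr x).2 = x.
Proof. by rewrite /tpoint -surjective_pairing reprK. Qed.

Lemma tpoint_eqP e f q r :
  (tpoint e q == tpoint f r) = zero_glue (e, q) (f, r).
Proof. exact: eqmodE. Qed.

Lemma tpoint_repr_glue e q : zero_glue (repr (tpoint e q)) (e, q).
Proof. by rewrite -eqmodE reprK. Qed.

Lemma speed_ge0 x : 0 <= speed x.
Proof. by rewrite /speed. Qed.

Lemma speed_tpoint e q : speed (tpoint e q) = q%:num.
Proof.
have := tpoint_repr_glue e q.
by rewrite /speed; case/predU1P => [->//|/and3P[/eqP -> /eqP/= ->]].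
Qed.

(** The canonical representative may pick the opposite edge, but only at speed 0, where neither the
    Lagrangian nor a form sees the difference. *)
Lemma repr_tpoint_edge e q : (repr (tpoint e q)).1 = e \/
  (repr (tpoint e q)).1 = rev_edge e /\ q%:num = 0.
Proof.
have := tpoint_repr_glue e q.
by case/predU1P => [->|/and3P[_ /= /eqP q0 /eqP ->]]; [left|right].
Qed.

Lemma tpoint_eq0 e f q r : q%:num = 0 -> r%:num = 0 ->
  (tpoint e q == tpoint f r) = (e == f) || (e == rev_edge f).
Proof.
move=> q0 r0; rewrite tpoint_eqP /zero_glue /= q0 r0 eqxx /=.
congr orb; apply/eqP/eqP => [[]//|->]; congr pair.
by apply/val_inj; rewrite /= q0 r0.
Qed.

Lemma tpoint_eq_gt0 e f q r : q%:num != 0 ->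
  (tpoint e q == tpoint f r) = (e == f) && (q == r).
Proof. by move=> q0; rewrite tpoint_eqP /zero_glue /= (negPf q0) orbF. Qed.

Lemma ray_tpoint e f q : @ray R G e (tpoint f q) <-> f = e \/ (q%:num = 0 /\ f = rev_edge e).
Proof.
split=> [[r _ /eqP]|].
  rewrite eq_sym tpoint_eqP => /predU1P[[->]|/and3P[/= /eqP q0 _ /eqP]]; first by left.
  by right.
case=> [->|[q0 ->]]; first by exists q.
by exists q => //; apply/eqP; rewrite tpoint_eq0// rev_edgeK eqxx orbT.
Qed.

Lemma speed_lipschitz x y : `|speed x - speed y| <= mdist x y.
Proof.
rewrite [mdist _ _]/(tangent_dist x y) /tangent_dist /ray_dist /speed.
case: (repr x) (repr y) => [e q] [f r] /=.
have q0 : 0 <= q%:num by [].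
have r0 : 0 <= r%:num by [].
move: q%:num r%:num q0 r0 => a b a0 b0.
by case: ifP => // _; case: ifP => _; rewrite ler_norml; apply/andP; split; lra.
Qed.

Lemma speed_continuous : continuous (@speed R G).
Proof.
move=> x; apply/(@cvgrPdist_lt _ _ _ (nbhs x) (nbhs_filter x)) => e e0.
apply: filterS (nbhsx_ballx x e e0) => y; rewrite ballEmdist.
exact: le_lt_trans (speed_lipschitz x y).
Qed.

Lemma measurable_tangent_open (A : set (borel_tangent R G)) :
  @open (tangent R G) A -> measurable A.
Proof. by move=> oA; apply: sub_sigma_algebra. Qed.

Lemma measurable_speed : measurable_fun setT (@speed R G : borel_tangent R G -> R).
Proof.
apply: (measurability _ (RGenOpens.measurableE R)) => _ [_ [a [b ->] <-]].
rewrite setTI; apply: measurable_tangent_open.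
by move/continuousP: speed_continuous; apply; exact: interval_open.
Qed.

Lemma closed_ray e : @closed (tangent R G) (@ray R G e).
Proof.
rewrite -openC openE => x /= xe; rewrite /interior.
pose f := (repr x).1; pose q := (repr x).2.
have xE : x = tpoint f q by rewrite tpoint_repr.
have fe : f != e by apply/eqP => fe; apply: xe; rewrite xE fe; exists q.
have qe : f = rev_edge e -> 0 < q%:num.
  move=> fe'; rewrite lt_def ge0 andbT; apply/eqP => q0; apply: xe.
  by rewrite xE ray_tpoint; right.
(* A lower bound of the distance from [x] to the ray: the speed of [x] on the opposite ray, 1 on the
   others. *)
pose d : R := if f == rev_edge e then q%:num else 1.
have d0 : 0 < d by rewrite /d; case: eqP => // /qe.
apply/nbhs_ballP; exists d => //= y.
rewrite ballEmdist/= => xyd /= -[r _ ry]; move: xyd; apply/negP.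
rewrite -leNgt -[mdist _ _]/(tangent_dist x y) /tangent_dist /ray_dist.
rewrite -/f -/q -{y}ry.
have q0 : 0 <= q%:num by [].
have := tpoint_repr_glue e r; case: (repr (tpoint e r)) => g s /=.
have s0 : 0 <= s%:num by [].
case/predU1P => [[-> ->]|/and3P[/= /eqP -> _ /eqP ->]].
  rewrite (negPf fe) /d; case: ifP => _; first by rewrite lerDl.
  by rewrite lerDr addr_ge0.
rewrite rev_edgeK (negPf fe) /d; case: ifP => _; last by rewrite addr0 lerDr.
by rewrite subr0 ler_norm.
Qed.

Lemma measurable_tangent_closed (A : set (borel_tangent R G)) :
  @closed (tangent R G) A -> measurable A.
Proof.
move=> cA; rewrite -(setCK A); apply: measurableC.
by apply: measurable_tangent_open; rewrite openC.
Qed.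

Lemma measurable_ray e : measurable (@ray R G e).
Proof. by apply: measurable_tangent_closed; exact: closed_ray. Qed.

Lemma measurable_tangent_set1 (x : borel_tangent R G) : measurable [set x].
Proof.
apply: measurable_tangent_closed.
by apply: (@accessible_closed_set1 (tangent R G)); exact/hausdorff_accessible/metric_hausdorff.
Qed.

(** A preimage is a finite union, over the edges, of sets cut out of the closed rays by a measurable
    condition on the speed. *)
Lemma measurable_by_rays (F : borel_tangent R G -> R) (g : edge G -> R -> R) :
  (forall e, measurable_fun setT (g e)) ->
  (forall e q, F (tpoint e q) = g e q%:num) -> measurable_fun setT F.
Proof.
move=> mg Fg _ B mB; rewrite setTI.
rewrite (_ : _ @^-1` _ = \bigcup_(e in [set: edge G])
    (@ray R G e `&` ((g e \o @speed R G) @^-1` B))).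
  apply: fin_bigcup_measurable => // e _.
  apply: measurableI; first exact: measurable_ray.
  rewrite -[X in measurable X]setTI.
  exact: (measurableT_comp (mg e) measurable_speed).
apply/seteqP; split => [x /= Bx|_ [e _ [[q _ <-]]]] /=; last first.
  by rewrite speed_tpoint Fg.
exists (repr x).1 => //; split; first by exists (repr x).2 => //; rewrite tpoint_repr.
by rewrite /= /speed -Fg tpoint_repr.
Qed.

(** * Lagrangian and forms as functions on the tangent bundle *)

Section Lagrangian.
Variables (H : edge G -> R -> R) (HH : hamiltonian H).

Lemma lagrangian_tpoint e q : lagrangian H (tpoint e q) = lagrangian_edge H e q%:num.
Proof.
rewrite /lagrangian speed_tpoint.
by case: (repr_tpoint_edge e q) => [->//|[-> ->]]; rewrite -(lagrangian_edge0 HH).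
Qed.

Lemma twisted_lagrangian_tpoint w e q :
  twisted_lagrangian H w (tpoint e q) = lagrangian_edge H e q%:num - q%:num * w e.
Proof.
rewrite /twisted_lagrangian lagrangian_tpoint speed_tpoint.
by case: (repr_tpoint_edge e q) => [->//|[_ ->]]; rewrite !mul0r.
Qed.

Lemma measurable_lagrangian :
  measurable_fun setT (lagrangian H : borel_tangent R G -> R).
Proof.
exact: measurable_by_rays (measurable_lagrangian_edge HH) lagrangian_tpoint.
Qed.

End Lagrangian.

Definition form_density (w : cochain1 R G) (x : borel_tangent R G) : R :=
  speed x * w (repr x).1.

Lemma form_density_tpoint w e q : form_density w (tpoint e q) = q%:num * w e.
Proof.
rewrite /form_density speed_tpoint.
by case: (repr_tpoint_edge e q) => [->//|[_ ->]]; rewrite !mul0r.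
Qed.

Lemma measurable_form_density w : measurable_fun setT (form_density w).
Proof.
have mg e : measurable_fun setT (fun q : R => q * w e).
  by apply: measurable_funM.
exact: (measurable_by_rays mg (form_density_tpoint w)).
Qed.

End TangentPoints.

(** * Finitely supported measures *)

(** The integral is the difference of those of the positive and negative parts in the extended
    reals, which is finite only if both are. *)
Lemma integrable_fin_integral d (T : measurableType d) (R : realType)
    (mu : {measure set T -> \bar R}) (F : T -> R) (b : R) :
  measurable_fun setT F -> (\int[mu]_x (F x)%:E = b%:E)%E ->
  mu.-integrable setT (EFin \o F).
Proof.
move=> mF Fb; apply/integrableP; split; first exact/measurable_EFinP.
by rewrite (integral_fin_num_abs mu measurableT mF) Fb.
Qed.

Section WeightedPoints.
Context d (T : measurableType d) (R : realType) (I : finType).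
Implicit Types (m : I -> R) (x : I -> T).

Let weighted_measure (r : seq I) m x : (forall i, 0 <= m i) ->
  exists mu : {measure set T -> \bar R},
    (forall A, mu A = \sum_(i <- r) (m i)%:E * \d_(x i) A)%E /\
    (forall f : T -> \bar R, measurable_fun setT f -> (forall t, 0 <= f t)%E ->
      \int[mu]_t f t = \sum_(i <- r) (m i)%:E * f (x i))%E.
Proof.
move=> m0; elim: r => [|i r [mu [muE muI]]].
  exists mzero; split=> [A|f mf f0]; rewrite big_nil//.
  exact: integral_measure_zero.
exists (measure_add (mscale (NngNum (m0 i)) (dirac (x i))) mu); split=> [A|f mf f0].
  by rewrite big_cons -muE; exact: measure_addE.
rewrite ge0_integral_measure_add// big_cons muI//; congr (_ + _)%E.
by rewrite ge0_integral_mscale// integral_dirac// diracT mul1e.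
Qed.

(** The integral depends only on the measurable sets, so a constructed measure replaces [mu]; its
    formula for nonnegative functions is applied to the positive and negative parts. *)
Lemma integral_weighted (mu : {measure set T -> \bar R}) m x (f : T -> R) :
  (forall i, 0 <= m i) ->
  (forall A, measurable A -> mu A = \sum_i (m i)%:E * \d_(x i) A)%E ->
  measurable_fun setT f ->
  (\int[mu]_t (f t)%:E)%E = (\sum_i m i * f (x i))%:E.
Proof.
move=> m0 muE mf; have [nu [nuE nuI]] := weighted_measure (index_enum I) x m0.
rewrite (eq_measure_integral nu); last by move=> A mA _; rewrite muE// nuE.
have mEf : measurable_fun setT (EFin \o f) by exact/measurable_EFinP.
rewrite integralE !nuI//; last 2 first.
- exact: measurable_funeneg.
- exact: measurable_funepos.
rewrite (eq_bigr (fun i => (m i * Num.max (f (x i)) 0)%:E)); last first.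
  by move=> i _; rewrite funeposE -EFin_max EFinM.
rewrite [X in (_ - X)%E](eq_bigr (fun i => (m i * Num.max (- f (x i)) 0)%:E)); last first.
  by move=> i _; rewrite funenegE -EFinN -EFin_max EFinM.
rewrite !sumEFin -EFinB -sumrB; congr EFin; apply: eq_bigr => i _.
by rewrite -mulrBr; congr *%R; case: (leP (f (x i)) 0); case: (leP (- f (x i)) 0); lra.
Qed.

Lemma weighted_probability m x : (forall i, 0 <= m i) -> \sum_i m i = 1 ->
  exists mu : probability T R,
    forall A, (mu A = \sum_i (m i)%:E * \d_(x i) A)%E.
Proof.
move=> m0 m1; have [nu [nuE _]] := weighted_measure (index_enum I) x m0.
have nu1 : nu setT = 1%E.
  rewrite nuE -[RHS]/(1%:E) -m1 -sumEFin; apply: eq_bigr => i _.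
  by rewrite diracT mule1.
have [i _|I0] := pickP (@predT I); last first.
  by move: m1; rewrite big_pred0// => /esym/eqP; rewrite oner_eq0.
(* [nu] has mass 1, so normalization leaves it unchanged and only provides the structure of a
   probability; the Dirac mass is the fallback for a degenerate mass. *)
exists (mnormalize nu (dirac (x i))) => A.
by rewrite [LHS]/(mnormalize nu (dirac (x i)) A) /mnormalize nu1 onee_eq0/= invr1 mule1 nuE.
Qed.

(** Up to a null set, [A] is the disjoint union of the points [x i] in it with [i] in [P];
    restricting to [P] prevents a point with several indices from being counted twice. *)
Lemma concentrated_weighted (mu : probability T R) (P : {pred I}) x :
  {in P &, injective x} -> (forall i, measurable [set x i]) ->
  mu (~` [set x i | i in [set` P]]) = 0%E ->
  forall A, measurable A ->
    (mu A = \sum_i (if i \in P then fine (mu [set x i]) else 0)%:E * \d_(x i) A)%E.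
Proof.
move=> xinj mx muP A mA.
pose F i := if i \in P then A `&` [set x i] else set0.
have mF i : measurable (F i).
  by rewrite /F; case: ifP => // _; exact: measurableI.
have mU : measurable (\bigcup_(i in [set: I]) F i).
  by apply: fin_bigcup_measurable.
have AE : A = (\bigcup_(i in [set: I]) F i) `|` (A `&` ~` [set x i | i in [set` P]]).
  apply/seteqP; split => [t At|t [[i _]|[]//]]; last by rewrite /F; case: ifP => // _ [].
  have [[i Pi xi]|nx] := pselect ([set x i | i in [set` P]] t); last by right.
  by left; exists i => //; rewrite /F (_ : i \in P)//; split => //; rewrite /= xi.
have mS : measurable (~` [set x i | i in [set` P]]).
  apply: measurableC; rewrite -bigcup_imset1; apply: fin_bigcup_measurable => //.
have -> : mu A = mu (\bigcup_(i in [set: I]) F i).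
  rewrite {1}AE measureU0//; first exact: measurableI.
  by apply: subset_measure0 muP => //; apply: measurableI.
have finI : finite_set [set: I] by exact: finite_finset.
rewrite measure_fin_bigcup//; last first.
  move=> i j _ _; rewrite /F; case: ifP => iP; last by rewrite set0I => -[].
  case: ifP => jP; last by rewrite setI0 => -[].
  by move=> [t [[_ /= ti] [_ /= tj]]]; apply: xinj => //; rewrite -ti -tj.
rewrite (_ : [set: I] = [set` xpredT]); last by apply/seteqP; split.
rewrite -(bigfs _ (index_enum_uniq I)) => [|i _]; last by rewrite mem_index_enum.
apply: eq_bigr => i _.
rewrite /F; case: ifP => iP; last by rewrite measure0 mul0e.
rewrite fineK ?fin_num_measure// diracE.
have [xA|xA] := boolP (x i \in A).
  by rewrite mule1; congr (mu _); apply/setIidPr => t ->; rewrite inE in xA.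
rewrite mule0 (_ : A `&` _ = set0) ?measure0//; apply/seteqP; split => // t [At /= tx].
by move: xA; rewrite notin_setE -tx.
Qed.

End WeightedPoints.

(** * Rotation vectors *)

Section Rotation.
Variables (R : realType) (G : graph).
Implicit Types (w : cochain1 R G) (mu : borel_probability R G).

Lemma cochain1_rev w e : w (rev_edge e) = - w e.
Proof. exact: (eqP (forallP (cochain1P w) e)). Qed.

Lemma sum_cochain1 w : \sum_e w e = 0.
Proof.
set s := \sum_e w e; suff : s = - s by lra.
rewrite {1}/s (reindex_inj (can_inj (@rev_edgeK G))) /s -sumrN.
by apply: eq_bigr => e _; rewrite cochain1_rev.
Qed.

(** Two representatives of a chain differ by a reversal-invariant function; its product with [w] is
    antisymmetric and sums to 0. *)
Lemma pairing_pi w (v : {ffun edge G -> R}) :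
  pairing w (\pi_(chain1 R G) v) = \sum_e v e * w e.
Proof.
rewrite /pairing; set r := repr _.
have /forallP rv : r - v \in @null_combination R G.
  by rewrite Quotient.idealrBE; apply/eqP; rewrite reprK.
have uP : antisymmetric_edge [ffun e => (r - v) e * w e].
  apply/forallP => e; rewrite [in X in X == _]ffunE [in X in _ == X]ffunE.
  by rewrite (eqP (rv e)) cochain1_rev mulrN.
apply/eqP; rewrite -subr_eq0 -sumrB -[X in _ == X](sum_cochain1 (Cochain1 uP)); apply/eqP.
by apply: eq_bigr => e _; rewrite !ffunE mulrBl.
Qed.

Lemma integral_formE w mu :
  integral_form w mu = \sum_e (\int[mu]_(x in @ray R G e) speed x)%R * w e.
Proof.
by rewrite /integral_form pairing_pi; apply: eq_bigr => e _; rewrite ffunE.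
Qed.

Lemma integrable_speed mu : finite_first_moment mu ->
  mu.-integrable setT (EFin \o @speed R G).
Proof.
move=> fm; apply/integrableP; split.
  by apply/measurable_EFinP; exact: measurable_speed.
by under eq_integral do rewrite /= ger0_norm ?speed_ge0//.
Qed.

(** A moving point lies on one ray only; a point at rest lies on two, but contributes 0 to both
    sides. *)
Lemma form_density_sum w (x : borel_tangent R G) :
  form_density w x = \sum_e w e * ((@speed R G) \_ (@ray R G e)) x.
Proof.
have [f [q xE]] : exists f q, x = tpoint f q.
  by exists (repr x).1, (repr x).2; rewrite tpoint_repr.
rewrite xE form_density_tpoint; have [q0|q0] := eqVneq q%:num 0.
  rewrite q0 mul0r big1// => e _; rewrite /patch speed_tpoint q0.
  by case: ifP; rewrite mulr0.
rewrite (bigD1 f)//= big1 ?addr0.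
  have rf : @ray R G f (tpoint f q) by apply/ray_tpoint; left.
  by rewrite /patch (mem_set rf) speed_tpoint mulrC.
move=> e ef; have nr : ~ @ray R G e (tpoint f q).
  by move=> /ray_tpoint[fe|[]/eqP]; [rewrite fe eqxx in ef|rewrite (negPf q0)].
by rewrite /patch (memNset nr) mulr0.
Qed.

(** Turns the algebraic definition of the integral of a form, through [rho], into a Lebesgue
    integral on the tangent bundle. *)
Lemma integral_form_density w mu : finite_first_moment mu ->
  mu.-integrable setT (EFin \o form_density w) /\
  (\int[mu]_x (form_density w x)%:E)%E = (integral_form w mu)%:E.
Proof.
move=> fm; have sint := integrable_speed fm.
have fE : EFin \o form_density w =
    fun x => (\sum_e (w e)%:E * ((EFin \o @speed R G) \_ (@ray R G e)) x)%E.
  apply/funext => x /=; rewrite form_density_sum -sumEFin; apply: eq_bigr => e _.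
  by rewrite EFinM /patch; case: ifP.
have sint_ e : mu.-integrable (@ray R G e) (EFin \o @speed R G).
  by apply: integrableS sint => //; exact: measurable_ray.
have pint e : mu.-integrable setT ((EFin \o @speed R G) \_ (@ray R G e)).
  apply/integrable_restrict => //; first exact: measurable_ray.
  by rewrite setTI.
have wint e : mu.-integrable setT (fun x => (w e)%:E * ((EFin \o @speed R G) \_ (@ray R G e)) x)%E.
  exact: integrableZl.
rewrite -[X in (\int[_]_x X x)%E]/(EFin \o form_density w) fE; split.
  exact: integrable_sum.
rewrite integral_sum// integral_formE -sumEFin; apply: eq_bigr => e _.
rewrite integralZl// -integral_mkcond EFinM muleC; congr (_ * _)%E.
rewrite /Rintegral fineK//; apply: integrable_fin_num => //.
exact: measurable_ray.
Qed.

(** * Rotation and action of finitely supported measures *)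

Section WeightedMeasure.
Variables (I : finType) (m : I -> R) (e : I -> edge G) (q : I -> {nonneg R}).
Variable mu : borel_probability R G.
Hypothesis m0 : forall i, 0 <= m i.
Hypothesis muE : forall A, measurable A ->
  (mu A = \sum_i (m i)%:E * \d_(tpoint (e i) (q i) : borel_tangent R G) A)%E.

Lemma finite_first_moment_weighted : finite_first_moment mu.
Proof.
rewrite /finite_first_moment (integral_weighted m0 muE) ?ltry//.
exact: measurable_speed.
Qed.

Lemma integral_form_weighted w :
  integral_form w mu = \sum_i m i * ((q i)%:num * w (e i)).
Proof.
apply: EFin_inj; rewrite -(integral_form_density w finite_first_moment_weighted).2.
rewrite (integral_weighted m0 muE); last exact: measurable_form_density.
by congr EFin; apply: eq_bigr => i _; rewrite form_density_tpoint.
Qed.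

(** Closedness of a finitely supported measure is conservation of the flow [m i * q i] at the
    vertices. *)
Lemma closed_weighted :
  (forall f : cochain0 R G,
    \sum_i m i * (q i)%:num * (f (term (e i)) - f (orig (e i))) = 0) <->
  closed_measure mu.
Proof.
have E (f : cochain0 R G) : \sum_i m i * (q i)%:num * (f (term (e i)) - f (orig (e i))) =
    integral_form (coboundary f) mu.
  by rewrite integral_form_weighted; apply: eq_bigr => i _; rewrite ffunE mulrA.
split=> [f0|[_ f0] f]; last by rewrite E.
by split=> [|f]; [exact: finite_first_moment_weighted|rewrite -E].
Qed.

Lemma twisted_action_weighted H w : hamiltonian H ->
  twisted_action H w mu =
  (\sum_i m i * (lagrangian_edge H (e i) (q i)%:num - (q i)%:num * w (e i)))%:E.
Proof.
move=> HH; rewrite /twisted_action (integral_weighted m0 muE); last first.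
  by apply: measurable_funB; [exact: measurable_lagrangian|exact: measurable_form_density].
by congr EFin; apply: eq_bigr => i _; rewrite twisted_lagrangian_tpoint.
Qed.

Lemma action_weighted H : hamiltonian H ->
  action H mu = (\sum_i m i * lagrangian_edge H (e i) (q i)%:num)%:E.
Proof.
move=> HH; rewrite /action (integral_weighted m0 muE); last exact: measurable_lagrangian.
by congr EFin; apply: eq_bigr => i _; rewrite lagrangian_tpoint.
Qed.

End WeightedMeasure.

(** Summation by parts: [coboundary] is adjoint to [boundary]. *)
Lemma boundary_pairing (f : cochain0 R G) (h : chain1 R G) :
  pairing (coboundary f) h = \sum_x f x * boundary h x.
Proof.
rewrite /pairing; under [RHS]eq_bigr do rewrite ffunE mulr_sumr.
rewrite exchange_big/=; apply: eq_bigr => e _; rewrite ffunE.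
have delta y : \sum_(x : vertex G) f x * (y == x)%:R = f y.
  rewrite (bigD1 y)//= eqxx mulr1 big1 ?addr0// => x xy.
  by rewrite eq_sym (negPf xy) mulr0.
rewrite -[in LHS](delta (term e)) -[in LHS](delta (orig e)) -sumrB mulr_sumr.
by apply: eq_bigr => x _; ring.
Qed.

Lemma closed_measure_homology mu : closed_measure mu -> homology1 (rho mu).
Proof.
move=> [_ cmu]; apply/ffunP => x; rewrite [RHS]ffunE.
have := cmu [ffun y => (x == y)%:R]; rewrite /integral_form boundary_pairing.
rewrite (bigD1 x)//= big1 ?addr0 ?ffunE ?eqxx ?mul1r// => y yx.
by rewrite ffunE eq_sym (negPf yx) mul0r.
Qed.

Lemma homology_pairing (f : cochain0 R G) h : homology1 h ->
  pairing (coboundary f) h = 0.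
Proof.
by move=> hb; rewrite boundary_pairing hb big1// => x _; rewrite ffunE mulr0.
Qed.

Lemma cohomology_eq w w' :
  \pi_(cohomology1 R G) w = \pi_(cohomology1 R G) w' <->
  exists f : cochain0 R G, forall e, w e = w' e + (f (term e) - f (orig e)).
Proof.
split=> [/eqP|[f wf]].
  rewrite -Quotient.idealrBE => /asboolP[f wf]; exists f => e.
  have := congr1 (fun u : cochain1 R G => u e) wf; rewrite /= !ffunE.
  by lra.
apply/eqP; rewrite -Quotient.idealrBE; apply/asboolP; exists f.
by apply/val_inj/ffunP => e /=; rewrite !ffunE wf; lra.
Qed.

End Rotation.

(** * Circuits and circulations *)

Section EdgeSubgraph.
Variables (R : realType) (G : graph) (P : pred (edge G)).

Definition edge_rel : rel (vertex G) :=
  [rel a b | [exists e : edge G, [&& P e, orig e == a & term e == b]]].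

Lemma edge_rel_edge e : P e -> edge_rel (orig e) (term e).
Proof. by move=> Pe; apply/existsP; exists e; rewrite Pe !eqxx. Qed.

(** The last clause lets any edge ending at [x] be put in front of the lifted path. *)
Lemma edge_path x p : path edge_rel x p ->
  exists s : seq (edge G), [/\ all P s, map (@term G) s = p
    & forall f, term f = x -> path (@consecutive G) f s].
Proof.
elim: p x => [x _|y p IHp x /= /andP[/existsP[e /and3P[Pe /eqP ox /eqP ty]] yp]].
  by exists [::].
have [s [Ps sp ps]] := IHp _ yp; exists (e :: s); split=> [|/=|f fx /=].
- by rewrite /= Pe.
- by rewrite ty sp.
- by rewrite ps// andbT /consecutive /= fx ox.
Qed.

(** Once repetitions are removed from a path back to [orig e], its vertices, [term e] included, are
    the distinct ends of the edges of a circuit through [e]. *)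
Lemma connect_circuit e : P e -> connect edge_rel (term e) (orig e) ->
  exists z : seq (edge G), is_circuit z /\ all P z.
Proof.
move=> Pe /connectP[p0 pp]; case: (shortenP pp) => p {}pp up _ oe.
have [s [Ps sp ps]] := edge_path pp.
exists (e :: s); split; last by rewrite /= Pe.
rewrite /is_circuit /is_cycle /= rcons_path ps//= /consecutive /=.
by rewrite -last_map sp -oe eqxx /=.
Qed.

Lemma acyclic_potential :
  (forall e, P e -> ~~ connect edge_rel (term e) (orig e)) ->
  exists g : cochain0 R G, forall e, P e -> g (term e) < g (orig e).
Proof.
(* Along [e] the set of reachable vertices loses [orig e] and gains nothing. *)
move=> acyc; exists [ffun x => #|connect edge_rel x|%:R] => e Pe.
rewrite !ffunE ltr_nat; apply: proper_card; apply/properP; split.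
  apply/fintype.subsetP => x; rewrite !unfold_in; apply: connect_trans.
  exact/connect1/edge_rel_edge.
by exists (orig e); rewrite unfold_in; [exact: connect0|exact: acyc].
Qed.

(** The test function is the indicator of the set reachable from [term e]. No flow leaves this set,
    so by conservation none enters it, whereas [e] would if [orig e] lay outside. *)
Lemma circulation_connect (k : edge G -> R) e :
  (forall e, P e = (0 < k e)) -> (forall e, 0 <= k e) ->
  (forall f : cochain0 R G, \sum_e k e * (f (term e) - f (orig e)) = 0) ->
  P e -> connect edge_rel (term e) (orig e).
Proof.
move=> Pk k0 kcl Pe; apply/negPn/negP => nc.
have := kcl [ffun x => (connect edge_rel (term e) x)%:R].
rewrite (bigD1 e)//= !ffunE connect0 (negPf nc) subr0 mulr1 => ke.
have ke0 : 0 < k e by rewrite -Pk.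
suff : 0 <= \sum_(i | i != e) k i *
    (([ffun x => (connect edge_rel (term e) x)%:R] : cochain0 R G) (term i) -
     ([ffun x => (connect edge_rel (term e) x)%:R] : cochain0 R G) (orig i)) by lra.
apply: sumr_ge0 => i _; rewrite !ffunE.
have [Pi|] := boolP (P i); last first.
  by rewrite Pk -leNgt => ki; have -> : k i = 0 by have := k0 i; lra.
apply: mulr_ge0 => //; rewrite subr_ge0 ler_nat.
case: (boolP (connect _ _ (orig i))) => //= co.
by rewrite (connect_trans co)// connect1// edge_rel_edge.
Qed.

End EdgeSubgraph.

(** * Sums and flows along circuits *)

Section Circuits.
Variables (R : realType) (G : graph).
Implicit Types z : seq (edge G).

Lemma map_orig_belast (e : edge G) s : path (@consecutive G) e s ->
  map (@orig G) s = map (@term G) (belast e s).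
Proof. by elim: s e => //= f s IHs e /andP[/eqP <- /IHs ->]. Qed.

Lemma perm_orig_term z : cycle (@consecutive G) z ->
  perm_eq (map (@orig G) z) (map (@term G) z).
Proof.
case: z => // e s /= /map_orig_belast; rewrite belast_rcons map_rcons /= => <-.
by rewrite perm_sym perm_rcons.
Qed.

Lemma sum_cycle_coboundary z (f : cochain0 R G) : cycle (@consecutive G) z ->
  \sum_(e <- z) (f (term e) - f (orig e)) = 0.
Proof.
move=> cz; rewrite sumrB -(big_map (@term G) predT f) -(big_map (@orig G) predT f).
by rewrite (perm_big _ (perm_orig_term cz)) subrr.
Qed.

Lemma cycle_consecutive_nth e0 z i : cycle (@consecutive G) z ->
  (i.+1 < size z)%N -> term (nth e0 z i) = orig (nth e0 z i.+1).
Proof.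
case: z => //= a s; rewrite rcons_path => /andP[/(pathP e0) pz _] iz.
exact/eqP/pz.
Qed.

Lemma circuit_uniq z : is_circuit z -> uniq z.
Proof. by case/andP => _ /map_uniq. Qed.

Lemma circuit_circulation_const N (z : N.-tuple (edge G)) (k : 'I_N -> R) :
  is_circuit z ->
  (forall f : cochain0 R G,
    \sum_i k i * (f (term (tnth z i)) - f (orig (tnth z i))) = 0) ->
  forall i j, k i = k j.
Proof.
case/andP => /andP[_ cz] ut kcl.
have uo : uniq (map (@orig G) z) by rewrite (perm_uniq (perm_orig_term cz)).
have step (i j : 'I_N) : j = i.+1 :> nat -> k i = k j.
  move=> ji; pose e0 := tnth z i.
  have tE (l : 'I_N) : tnth z l = nth e0 z l by exact: tnth_nth.
  have toE : term (tnth z i) = orig (tnth z j).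
    by rewrite !tE ji; apply: cycle_consecutive_nth; rewrite // size_tuple -ji.
  have tinj (l : 'I_N) : (term (tnth z l) == term (tnth z i)) = (l == i).
    have nE n : (n < N)%N -> term (nth e0 z n) = nth (term e0) (map (@term G) z) n.
      by move=> nN; rewrite (nth_map e0)// size_tuple.
    by rewrite !tE !nE// nth_uniq// size_map size_tuple.
  have oinj (l : 'I_N) : (orig (tnth z l) == orig (tnth z j)) = (l == j).
    have nE n : (n < N)%N -> orig (nth e0 z n) = nth (orig e0) (map (@orig G) z) n.
      by move=> nN; rewrite (nth_map e0)// size_tuple.
    by rewrite !tE !nE// nth_uniq// size_map size_tuple.
  (* The indicator of the vertex between the edges [i] and [j]: of the edges of the circuit only [i]
     ends and only [j] starts there. *)
  have := kcl [ffun x => (x == term (tnth z i))%:R].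
  under eq_bigr do rewrite !ffunE tinj toE oinj mulrBr.
  rewrite sumrB (bigD1 i)//= big1 => [|l /negPf->]; last by rewrite mulr0.
  rewrite (bigD1 j)//= big1 => [|l /negPf->]; last by rewrite mulr0.
  by rewrite !eqxx !mulr1 !addr0; lra.
have all0 n (i j : 'I_N) : j = (i + n)%N :> nat -> k i = k j.
  elim: n i j => [i j|n IHn i j jin]; first by rewrite addn0 => /val_inj ->.
  have lt : (i + n < N)%N by rewrite (leq_trans _ (ltn_ord j))// jin addnS.
  by rewrite (IHn i (Ordinal lt))//; apply: step; rewrite jin addnS.
move=> i j; case: (leqP i j) => [ij|/ltnW ij].
  by apply: (all0 (j - i)%N); rewrite subnKC.
by apply/esym; apply: (all0 (i - j)%N); rewrite subnKC.
Qed.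

End Circuits.

(** * The critical value *)

Section CriticalValue.
Import ArrowAsProduct.
Variables (R : realType) (G : graph) (H : edge G -> R -> R).
Hypotheses (Gconn : connected_graph G) (HH : hamiltonian H).
Variable w : cochain1 R G.

Lemma subsolutionP a (u : cochain0 R G) : subsolution (twist H w) a u <->
  forall e, H e (u (term e) - u (orig e) + w e) <= a.
Proof.
split=> [su e|su x e _]; last by rewrite /twist ffunE; exact: su.
by have := su _ e erefl; rewrite /twist ffunE.
Qed.

Let e0 : edge G := enum_val (Ordinal (edge_card_gt0 G)).

Lemma critical_value_le a (u : cochain0 R G) : subsolution (twist H w) a u ->
  critical_value (twist H w) <= a.
Proof.
move=> su; apply: ge_inf; last by exists u.
exists (min_level H e0) => b [v /subsolutionP/(_ e0)].
by apply: le_trans; exact: minimizer_le.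
Qed.

(** The lowest level at which [u] is a subsolution; the starting value is below the term of [e0], so
    it does not affect the maximum. *)
Let level (u : vertex G -> R) : R :=
  \big[Num.max/min_level H e0]_e H e (u (term e) - u (orig e) + w e).

Let level_le u a : level u <= a <->
  forall e, H e (u (term e) - u (orig e) + w e) <= a.
Proof.
split=> [/bigmax_leP[_ ua] e|ua]; first exact: ua.
apply/bigmax_leP; split=> // ; apply: le_trans (ua e0); exact: minimizer_le.
Qed.

Let level_continuous : continuous level.
Proof.
rewrite /level; elim: (index_enum _) => [|e r IHr] u.
  set g := (X in continuous_at _ X).
  have -> : g = fun=> min_level H e0 by apply/funext => v; rewrite /g big_nil.
  exact: cst_continuous.
set g := (X in continuous_at _ X).
have -> : g = (fun v => H e (v (term e) - v (orig e) + w e)) \max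
    (fun v => \big[Num.max/min_level H e0]_(f <- r)
        H f (v (term f) - v (orig f) + w f)).
  by apply/funext => v; rewrite /g big_cons.
apply: continuous_max.
  apply: (continuous_comp (f := fun u : vertex G -> R => u (term e) - u (orig e) + w e)).
    have cp x : {for u, continuous (fun v : vertex G -> R => v x : R)}.
      exact: proj_continuous.
    have c1 := continuousB (cp (term e)) (cp (orig e)).
    have cw : {for u, continuous (fun v : vertex G -> R => w e : R)} by exact: cst_continuous.
    have c2 := continuousD c1 cw; exact: c2.
  exact: hamiltonian_continuous.
exact: IHr.
Qed.

(** The bounds on the edges of a path from [orig e0] to [x] add up. *)
Let bounded_oscillation (B : edge G -> R) (x : vertex G) :
  exists2 b, 0 <= b & forall u : vertex G -> R,
    (forall e, `|u (term e) - u (orig e)| <= B e) -> `|u x - u (orig e0)| <= b.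
Proof.
have /connectP[p] := Gconn (orig e0) x.
elim: p (orig e0) => [y _ ->|y p IHp z /= /andP[/existsP[e /andP[/eqP oe /eqP te]] yp] xy].
  by exists 0 => // u _; rewrite subrr normr0.
have [b b0 ub] := IHp y yp xy; exists (b + `|B e|) => [|u uB].
  by rewrite addr_ge0.
have -> : u x - u z = (u x - u y) + (u (term e) - u (orig e)) by rewrite oe te; ring.
apply: le_trans (ler_normD _ _) _; apply: lerD; first exact: ub.
exact: le_trans (uB e) (ler_norm _).
Qed.

(** Constants do not change the level. Normalized to vanish at [orig e0], the functions not above
    the level of 0 lie in a product of segments, compact by Tychonoff, on which the continuous level
    has a minimum. *)
Lemma critical_subsolution_exists :
  exists u, subsolution (twist H w) (critical_value (twist H w)) u.
Proof.
pose z : vertex G -> R := fun=> 0.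
have /choice[B hB] e : exists b, forall p, H e (p + w e) <= level z -> `|p| <= b.
  have [b hb] := hamiltonian_bound HH e (level z); exists (b + `|w e|) => p /hb.
  by have := ler_normB (p + w e) (w e); rewrite addrK; lra.
have /choice[b hb] x : exists b, 0 <= b /\ forall u : vertex G -> R,
    (forall e, `|u (term e) - u (orig e)| <= B e) -> `|u x - u (orig e0)| <= b.
  by have [b] := bounded_oscillation B x; exists b.
pose A := [set u : vertex G -> R | forall x, `[- b x, b x]%classic (u x)].
have A0 : A z by move=> x /=; rewrite in_itv/= oppr_le0 !(hb x).1.
have cA : compact A.
  apply: (@tychonoff _ _ (fun x => `[- b x, b x]%classic)) => x.
  exact: segment_compact.
have [v _ vmin] : exists2 v, v \in A & forall u, u \in A -> level v <= level u.
  apply: compact_EVT_min => //; first by exists z.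
  exact/continuous_subspaceT/level_continuous.
have vle u : level v <= level u.
  have [uz|/ltW zu] := leP (level u) (level z); last first.
    by apply: le_trans zu; apply: vmin; rewrite inE.
  pose u' x := u x - u (orig e0).
  have u'E e : u' (term e) - u' (orig e) = u (term e) - u (orig e).
    by rewrite /u'; ring.
  have -> : level u = level u' by apply: eq_bigr => e _; rewrite u'E.
  apply: vmin; rewrite inE => x /=; rewrite in_itv/= -ler_norml.
  by apply: (hb x).2 => e; apply: hB; move/level_le: uz.
exists (finfun v); apply/subsolutionP => e; rewrite !ffunE.
apply: le_trans (_ : level v <= _); first by move: e; apply/level_le.
apply: lb_le_inf.
  exists (level v), (finfun v); apply/subsolutionP => f; rewrite !ffunE.
  by move: f; apply/level_le.
move=> a [u /subsolutionP ua]; apply: le_trans (vle u) _; exact/level_le.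
Qed.

End CriticalValue.

(** * Circuit measures *)

Section CircuitMeasures.
Variables (R : realType) (G : graph).

(* If n is charged by m, then m = l n + (1 - l) (m - l n) / (1 - l) for small
   l, so extremality of m forces m = n. *)
Lemma irreducible_weighted (I : finType) (m n : I -> R) (e : I -> edge G)
    (q : I -> {nonneg R}) (mu : borel_probability R G) :
  (forall i, 0 <= m i) ->
  (forall A, measurable A ->
    (mu A = \sum_i (m i)%:E * \d_(tpoint (e i) (q i) : borel_tangent R G) A)%E) ->
  irreducible_measure mu ->
  (forall i, 0 <= n i) -> \sum_i n i = 1 -> (forall i, 0 < n i -> 0 < m i) ->
  (forall f : cochain0 R G,
    \sum_i n i * (q i)%:num * (f (term (e i)) - f (orig (e i))) = 0) ->
  forall A, measurable A ->
    (mu A = \sum_i (n i)%:E * \d_(tpoint (e i) (q i) : borel_tangent R G) A)%E.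
Proof.
move=> m0 muE [mucl muirr] n0 n1 nm ncl.
have m1 : \sum_i m i = 1.
  apply: EFin_inj; rewrite -sumEFin -[RHS](@probability_setT _ _ _ mu) muE//.
  by apply: eq_bigr => i _; rewrite diracT mule1.
have [nu nuE] := weighted_probability (fun i => tpoint (e i) (q i) : borel_tangent R G) n0 n1.
(* The least weight of [m] on the points charged by [n], which gives [l * n i <= m i]; the cap at
   one half keeps [1 - l] positive. *)
pose l : R := \big[Num.min/2^-1]_(i | 0 < n i) m i.
have l0 : 0 < l by apply/bigmin_gtP; split => [|i /nm//]; lra.
have l2 : l <= 2^-1 by exact: bigmin_le_id.
have lnm i : l * n i <= m i.
  have n_le1 : n i <= 1 by rewrite -n1 (bigD1 i)//= lerDl sumr_ge0.
  have := n0 i; rewrite le_eqVlt => /predU1P[<-|ni]; first by rewrite mulr0.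
  have lmi : l <= m i by exact: bigmin_le_cond.
  by have := m0 i; nra.
pose k i := (m i - l * n i) / (1 - l).
have k0 i : 0 <= k i by rewrite divr_ge0// ?subr_ge0//; lra.
have k1 : \sum_i k i = 1.
  by rewrite -mulr_suml sumrB -mulr_sumr m1 n1 mulr1 divff//; lra.
have [ka kaE] := weighted_probability (fun i => tpoint (e i) (q i) : borel_tangent R G) k0 k1.
have nucl : closed_measure nu by apply/(closed_weighted n0 (fun A _ => nuE A)).
have kacl : closed_measure ka.
  apply/(closed_weighted k0 (fun A _ => kaE A)) => f.
  have mcl := (closed_weighted m0 muE).2 mucl f.
  transitivity ((1 - l)^-1 *
    (\sum_i m i * (q i)%:num * (f (term (e i)) - f (orig (e i))) -
     l * \sum_i n i * (q i)%:num * (f (term (e i)) - f (orig (e i))))).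
    rewrite mulr_sumr -sumrB mulr_sumr; apply: eq_bigr => i _.
    by rewrite /k; ring.
  by rewrite mcl ncl; ring.
have mix A : measurable A -> (mu A = (1 - l)%:E * ka A + l%:E * nu A)%E.
  move=> mA; rewrite muE// nuE kaE !ge0_sume_distrr; last 2 first.
  - by move=> i _; rewrite mule_ge0// lee_fin.
  - by move=> i _; rewrite mule_ge0// lee_fin.
  rewrite -big_split/=; apply: eq_bigr => i _.
  by rewrite diracE -!EFinM -EFinD; congr EFin; rewrite /k; field; lra.
have same : same_measure ka nu.
  apply: contrapT => nsame; apply: muirr; exists ka, nu, l; split=> //.
  by apply/andP; split => //; lra.
move=> A mA; rewrite mix// same// -ge0_muleDl ?lee_fin; [|lra..].
by rewrite -EFinD subrK mul1e nuE.
Qed.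

(** * Occupation measure of a circuit crossed at positive speeds *)

Section Circuit.
Variables (N : nat) (z : N.-tuple (edge G)) (Q : 'I_N -> {nonneg R}).
Hypotheses (zC : is_circuit z) (Q0 : forall i, (Q i)%:num != 0).

(** The share of the period spent on the edge, which has length 1 and takes the inverse of the speed
    to cross. *)
Definition circuit_weight (i : 'I_N) : R :=
  (\sum_j (Q j)%:num^-1)^-1 * (Q i)%:num^-1.

Let time_gt0 : 0 < \sum_j (Q j)%:num^-1.
Proof.
have N0 : (0 < N)%N.
  by rewrite -(size_tuple z); case: (tval z) zC.
rewrite (bigD1 (Ordinal N0))//= ltr_pwDl ?invr_gt0 ?lt_def ?Q0 ?ge0//.
by apply: sumr_ge0 => i _; rewrite invr_ge0.
Qed.

Lemma circuit_weight_ge0 i : 0 <= circuit_weight i.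
Proof. by rewrite mulr_ge0// invr_ge0// ltW. Qed.

Lemma circuit_weight_sum : \sum_i circuit_weight i = 1.
Proof. by rewrite -mulr_sumr mulVf// gt_eqF. Qed.

(** The flow is the same on all edges, namely the inverse of the period; this makes the measure
    closed. *)
Lemma circuit_weight_speed i :
  circuit_weight i * (Q i)%:num = (\sum_j (Q j)%:num^-1)^-1.
Proof. by rewrite -mulrA mulVf// mulr1. Qed.

Lemma circuit_weight_closed (f : cochain0 R G) :
  \sum_i circuit_weight i * (Q i)%:num *
    (f (term (tnth z i)) - f (orig (tnth z i))) = 0.
Proof.
under eq_bigr do rewrite circuit_weight_speed.
rewrite -mulr_sumr -(big_tuple _ _ z predT (fun e => f (term e) - f (orig e))).
by rewrite sum_cycle_coboundary ?mulr0//; case/andP: zC => /andP[].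
Qed.

Lemma circuit_parametrized :
  parametrized_path z Q (fun i => (Q i)%:num^-1).
Proof.
have cz : cycle (@consecutive G) z by case/andP: zC => /andP[].
split.
- by move: cz; case: (tval z) => //= e s; rewrite rcons_path => /andP[].
- by move=> i; rewrite invr_gt0 lt_def Q0 ge0 div1r.
- by move=> /[swap] i /(_ i) Qi; have := Q0 i; rewrite Qi eqxx.
- by move=> i j _ Qi; have := Q0 i; rewrite Qi eqxx.
- move=> i i0 _; split=> [j ji _ Qk|Qk]; last first.
    have z0 : (0 < N)%N by exact: leq_ltn_trans (ltn_ord i).
    by have := Q0 (Ordinal z0); rewrite Qk ?eqxx.
  (* All speeds are nonzero, so the last moving index before [i] is its predecessor. *)
  have {Qk}ij : i = j.+1 :> nat.
    apply/eqP; rewrite eqn_leq ji andbT leqNgt; apply/negP => jk.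
    have kN : (j.+1 < N)%N by exact: ltn_trans jk (ltn_ord i).
    by have := Q0 (Ordinal kN); rewrite Qk ?eqxx//= ltnSn.
  have aux (e0 : edge G) : orig (tnth z i) = term (tnth z j).
    rewrite !(tnth_nth e0) ij; apply/esym; apply: cycle_consecutive_nth => //.
    by rewrite size_tuple -ij.
  exact: aux (tnth z i).
Qed.

Lemma circuit_occupation A :
  (occupation_measure z Q (fun i => (Q i)%:num^-1)%R A =
  \sum_i (circuit_weight i)%:E * \d_(tpoint (tnth z i) (Q i) : borel_tangent R G) A)%E.
Proof.
rewrite /occupation_measure ge0_sume_distrr => [|i _]; last first.
  by rewrite mule_ge0// lee_fin invr_ge0.
by apply: eq_bigr => i _; rewrite muleA -EFinM.
Qed.

Section Measure.
Variable mu : borel_probability R G.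
Hypothesis muE : forall A, measurable A -> (mu A =
  \sum_i (circuit_weight i)%:E * \d_(tpoint (tnth z i) (Q i) : borel_tangent R G) A)%E.

Lemma circuit_measure_closed : closed_measure mu.
Proof.
by apply/(closed_weighted circuit_weight_ge0 muE); exact: circuit_weight_closed.
Qed.

Lemma circuit_measure_supported : supported_on z mu.
Proof.
split=> //; exists Q, (fun i => (Q i)%:num^-1); split.
  exact: circuit_parametrized.
by move=> A mA; rewrite muE// circuit_occupation.
Qed.

Let points_inj : injective (fun i => tpoint (tnth z i) (Q i) : borel_tangent R G).
Proof.
move=> i j /eqP; rewrite tpoint_eq_gt0// => /andP[/eqP zij _].
by apply: (tuple_uniqP _ (circuit_uniq zC)).
Qed.

(* A closed measure charging only the points of mu carries a constant flow
   along the circuit, hence is mu itself. *)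
Let circuit_measure_unique (nu : borel_probability R G) : closed_measure nu ->
  nu (~` [set (tpoint (tnth z i) (Q i) : borel_tangent R G) | i in [set` predT]]) = 0%E ->
  same_measure nu mu.
Proof.
move=> nucl nu0.
pose m i : R := fine (nu [set (tpoint (tnth z i) (Q i) : borel_tangent R G)]).
have nuE A : measurable A -> (nu A =
    \sum_i (m i)%:E * \d_(tpoint (tnth z i) (Q i) : borel_tangent R G) A)%E.
  apply: concentrated_weighted nu0 A; first exact: (in2W points_inj).
  by move=> i; exact: measurable_tangent_set1.
have m0 i : 0 <= m i by rewrite fine_ge0.
have m1 : \sum_i m i = 1.
  apply: EFin_inj; rewrite -sumEFin -[RHS](@probability_setT _ _ _ nu) nuE//.
  by apply: eq_bigr => i _; rewrite diracT mule1.
have kc := circuit_circulation_const zC ((closed_weighted m0 nuE).2 nucl).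
move=> A mA; rewrite nuE// muE//; apply: eq_bigr => i _; congr (_%:E * _)%E.
have mj j : m j = m i * (Q i)%:num * (Q j)%:num^-1 by rewrite (kc i j) mulfK.
rewrite /circuit_weight.
(* Total mass 1 fixes the value of the constant flow. *)
have -> : (\sum_j (Q j)%:num^-1)^-1 = m i * (Q i)%:num.
  have : m i * (Q i)%:num * (\sum_j (Q j)%:num^-1) = 1.
    by rewrite mulr_sumr -m1; apply: eq_bigr => j _.
  by move=> /(canRL (mulfK (lt0r_neq0 time_gt0))) ->; rewrite mul1r.
by rewrite mulfK.
Qed.

(** Both components of a convex decomposition vanish where [mu] does, hence off the points of the
    circuit, so each of them equals [mu]. *)
Lemma circuit_measure_irreducible : irreducible_measure mu.
Proof.
split; first exact: circuit_measure_closed.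
move=> [mu1 [mu2 [l [cl1 cl2 ns /andP[l0 l1] mix]]]]; apply: ns => A mA.
set S := ~` [set (tpoint (tnth z i) (Q i) : borel_tangent R G) | i in [set` predT]].
have mS : measurable S.
  apply: measurableC; rewrite -bigcup_imset1; apply: fin_bigcup_measurable => // i _.
  exact: measurable_tangent_set1.
have muS : mu S = 0%E.
  rewrite muE// big1// => i _; rewrite diracE memNset ?mule0// => nS.
  by apply: nS; exists i.
have /eqP := mix S mS; rewrite muS eq_sym padde_eq0 ?mule_ge0 ?lee_fin//; [|lra..].
have l1' : 0 < 1 - l by lra.
rewrite !mule_eq0 !eqe (gt_eqF l0) (gt_eqF l1')/= => /andP[/eqP mu10 /eqP mu20].
by rewrite (circuit_measure_unique cl1 mu10) ?(circuit_measure_unique cl2 mu20).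
Qed.

End Measure.
End Circuit.
End CircuitMeasures.

(** * Calibrated cochains *)

Section MatherTheory.
Variables (R : realType) (G : graph) (H : edge G -> R -> R).
Hypotheses (Gconn : connected_graph G) (Gloop : loopless G) (HH : hamiltonian H).

Lemma sum_cycle_cohomologous (w v : cochain1 R G) (z : seq (edge G)) :
  \pi_(cohomology1 R G) w = \pi_(cohomology1 R G) v ->
  cycle (@consecutive G) z -> \sum_(e <- z) w e = \sum_(e <- z) v e.
Proof.
move=> /cohomology_eq[f wv] cz; under eq_bigr do rewrite wv.
by rewrite big_split/= sum_cycle_coboundary// addr0.
Qed.

Lemma sigma_path_cohomologous (w v : cochain1 R G) z a :
  \pi_(cohomology1 R G) w = \pi_(cohomology1 R G) v ->
  is_circuit z -> sigma_path H w z a = sigma_path H v z a.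
Proof.
move=> wv /andP[/andP[_ cz] _].
by rewrite /sigma_path !sumrB (sum_cycle_cohomologous wv cz).
Qed.

Lemma class_pairing_eq (v : cochain1 R G) h : homology1 h ->
  class_pairing (\pi_(cohomology1 R G) v) h = pairing v h.
Proof.
move=> hh; rewrite /class_pairing; set r := repr _.
have /cohomology_eq[f rv] : \pi_(cohomology1 R G) r = \pi_(cohomology1 R G) v.
  by rewrite reprK.
have := homology_pairing f hh; rewrite /pairing => fh.
rewrite /pairing -[RHS]addr0 -[X in _ + X]fh -big_split/=.
by apply: eq_bigr => e _; rewrite ffunE rv; ring.
Qed.

(** The differential of a critical subsolution is added to [w]; the last clause restates the
    minimality of the critical value for perturbations of [v]. *)
Lemma cohomologous_subsolution (w : cochain1 R G) :
  exists v : cochain1 R G,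
    [/\ \pi_(cohomology1 R G) v = \pi_(cohomology1 R G) w,
        forall e, H e (v e) <= critical_value (twist H w)
      & forall a (u : cochain0 R G),
          (forall e, H e (u (term e) - u (orig e) + v e) <= a) ->
          critical_value (twist H w) <= a].
Proof.
have [u /subsolutionP ua] := critical_subsolution_exists Gconn HH w.
have vE e : (w + coboundary u) e = w e + (u (term e) - u (orig e)).
  by rewrite /= !ffunE.
exists (w + coboundary u); split=> [|e|a u' ua'].
- by apply/cohomology_eq; exists u => e; rewrite vE.
- by rewrite vE addrC; exact: ua.
- apply: (critical_value_le HH (u := [ffun x => u' x + u x])).
  apply/subsolutionP => e; rewrite !ffunE; have := ua' e; rewrite vE.
  by congr (H e _ <= _); ring.
Qed.

(** * Fenchel's inequality for a critical representative *)

Section Calibrated.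
Variables (v : cochain1 R G) (a : R).
Hypothesis va : forall e, H e (v e) <= a.
Hypothesis a_crit : forall b (u : cochain0 R G),
  (forall e, H e (u (term e) - u (orig e) + v e) <= b) -> a <= b.

Lemma twisted_lagrangian_ge x : - a <= twisted_lagrangian H v x.
Proof.
rewrite -[x]tpoint_repr twisted_lagrangian_tpoint//.
have := fenchel_le HH (repr x).1 (v (repr x).1) (repr x).2%:num.
by have := va (repr x).1; lra.
Qed.

(** The twisted Lagrangian is at least [- H e (v e)], which is at least [- a]; both inequalities
    must be equalities. *)
Lemma twisted_lagrangian_calibrated e q :
  twisted_lagrangian H v (tpoint e q) <= - a ->
  H e (v e) = a /\ derive1 (H e) (v e) = q%:num.
Proof.
rewrite twisted_lagrangian_tpoint// => Lq; have vae := va e.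
have dv : derive1 (H e) (v e) = q%:num by apply: fenchel_eq => //; lra.
split=> //; have := lagrangian_edge_derive1 HH e (v e); rewrite dv.
by have := va e; lra.
Qed.

Lemma calibrated_action e : H e (v e) = a ->
  lagrangian_edge H e (derive1 (H e) (v e)) - derive1 (H e) (v e) * v e = - a.
Proof. by move=> vae; rewrite lagrangian_edge_derive1// vae; ring. Qed.

Lemma critical_cycle :
  (exists e, H e (v e) = a /\ derive1 (H e) (v e) = 0) \/
  exists z : seq (edge G), is_circuit z /\
    forall e, e \in z -> H e (v e) = a /\ 0 < derive1 (H e) (v e).
Proof.
pose P := [pred e | (H e (v e) == a) && (0 < derive1 (H e) (v e))].
have [/existsP[e0 /andP[Pe0 ce0]]|noC] :=
    boolP [exists e, P e && connect (edge_rel P) (term e) (orig e)].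
  right; have [z [zC /allP Pz]] := connect_circuit Pe0 ce0; exists z; split=> // e.
  by move=> /Pz /andP[/eqP].
left; apply: contrapT => no0.
have [g Pg] : exists g : cochain0 R G, forall e, P e -> g (term e) < g (orig e).
  apply: acyclic_potential => e Pe; apply: contraNN noC => ce.
  by apply/existsP; exists e; rewrite Pe.
(* Moving v along dg lowers H on every edge where it equals a. *)
have near_lt e : \forall t \near 0^'+, H e (v e + t * (g (term e) - g (orig e))) < a.
  have := va e; rewrite le_eqVlt => /predU1P[vae|vae]; last first.
    (* Where the level [a] is not reached, continuity at [t = 0] is enough. *)
    have cH : H e (v e + t * (g (term e) - g (orig e))) @[t --> (0 : R)^'+] --> H e (v e).
      apply: cvg_at_right_filter; set d := g (term e) - g (orig e).
      have : {for (0 : R), continuous (H e \o (fun t => v e + t * d))}.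
        apply: continuous_comp; last exact: hamiltonian_continuous.
        apply: cvgD; first exact: cvg_cst.
        by apply: cvgM; [exact: cvg_id|exact: cvg_cst].
      have E0 : (H e \o (fun t => v e + t * d)) 0 = H e (v e).
        by rewrite /comp mul0r addr0.
      by move=> cc; rewrite -E0; exact: cc.
    by apply: cvgr_lt cH _ vae.
  rewrite -vae; apply: hamiltonian_descent => //.
  have dn0 : derive1 (H e) (v e) != 0.
    by apply/eqP => d0; apply: no0; exists e.
  case: (ltgtP (derive1 (H e) (v e)) 0) dn0 => // dv _.
    (* A negative derivative on [e] is a positive one on the reversed edge, along which [g]
       decreases; hence [g] increases along [e]. *)
    have /Pg : P (rev_edge e).
      rewrite /P /= cochain1_rev derive1_rev// oppr_gt0 dv andbT.
      by rewrite (hamiltonian_rev HH) rev_edgeK opprK vae.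
    by rewrite /term rev_edgeK -/(term e) => dg; rewrite nmulr_rlt0// subr_gt0.
  have /Pg dg : P e by rewrite /P /= vae eqxx.
  by rewrite pmulr_rlt0// subr_lt0.
have [t ta] : exists t, forall e, H e (v e + t * (g (term e) - g (orig e))) < a.
  have : \forall t \near (0 : R)^'+, forall e, H e (v e + t * (g (term e) - g (orig e))) < a.
    exact: filter_forall.
  by move/filter_ex.
pose e0 : edge G := enum_val (Ordinal (edge_card_gt0 G)).
(* The largest of finitely many values below [a], which contradicts the minimality of [a]. *)
pose b := \big[Num.max/H e0 (v e0 + t * (g (term e0) - g (orig e0)))]_e
  H e (v e + t * (g (term e) - g (orig e))).
have ba : b < a by apply/bigmax_ltP; split.
suff : a <= b by lra.
apply: (@a_crit b [ffun x => t * g x]) => e; rewrite !ffunE.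
rewrite (_ : _ + v e = v e + t * (g (term e) - g (orig e))); last by ring.
exact: le_bigmax.
Qed.

Lemma action_ge (mu : borel_probability R G) b : closed_measure mu ->
  action H mu = b%:E -> pairing v (rho mu) - a <= b.
Proof.
move=> [fm _] mub.
have Lint := integrable_fin_integral (measurable_lagrangian HH) mub.
have [fint fE] := integral_form_density v fm.
have : (\int[mu]_x (- a)%:E <= \int[mu]_x ((lagrangian H x)%:E - (form_density v x)%:E))%E.
  apply: le_integral => //.
  - by apply/integrableP; split => //; rewrite integral_cst//= probability_setT mule1 ltry.
  - exact: integrableB.
  - by move=> x _; rewrite -EFinB lee_fin; exact: twisted_lagrangian_ge.
have cE : (\int[mu]_x (- a)%:E = (- a)%:E)%E.
  have -> := integral_cst mu measurableT (- a)%:E.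
  by rewrite [X in (_ * X)%E](@probability_setT _ _ _ mu) mule1.
rewrite integralB_EFin// fE cE.
rewrite -[(\int[mu]_x _)%E]/(action H mu) mub -EFinB lee_fin /integral_form.
by lra.
Qed.

End Calibrated.

Lemma pairing_separates (h h' : chain1 R G) :
  (forall w : cochain1 R G, pairing w h = pairing w h') -> h = h'.
Proof.
move=> hh; rewrite -(reprK h) -(reprK h'); apply/eqP.
rewrite -Quotient.idealrBE; set d := repr h - repr h'.
have wP : antisymmetric_edge [ffun e => d e - d (rev_edge e)].
  by apply/forallP => e; rewrite !ffunE rev_edgeK; apply/eqP; ring.
(* Twice the antisymmetric part of [d]: pairing [d] with it gives half the sum of its squares. *)
pose w : cochain1 R G := Cochain1 wP.
have dw : \sum_e d e * w e = 0.
  rewrite -[RHS](subrr (pairing w h')) -{1}hh /pairing -sumrB.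
  by apply: eq_bigr => e _; rewrite {1}/d !ffunE; ring.
have : \sum_e w e ^+ 2 = 0.
  have dw' : \sum_e d (rev_edge e) * w e = 0.
    transitivity (- \sum_e d e * w e); last by rewrite dw oppr0.
    rewrite (reindex_inj (can_inj (@rev_edgeK G))) -sumrN.
    by apply: eq_bigr => e _; rewrite rev_edgeK (cochain1_rev w) mulrN.
  transitivity (\sum_e d e * w e - \sum_e d (rev_edge e) * w e).
    rewrite -sumrB; apply: eq_bigr => e _.
    by rewrite [w e]ffunE; ring.
  by rewrite dw dw' subrr.
move/eqP; rewrite psumr_eq0 => [/allP w0|e _]; last exact: sqr_ge0.
apply/forallP => e; have := w0 e (mem_index_enum e).
by rewrite /= sqrf_eq0 [w e]ffunE subr_eq0 eq_sym.
Qed.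

(** Ensures that the infimum defining [beta] is over a nonempty set. *)
Lemma homology_action (h : chain1 R G) : homology1 h ->
  exists mu b, [/\ closed_measure mu, rho mu = h & action H mu = b%:E].
Proof.
move=> hh; pose r : {ffun edge G -> R} := repr h.
pose C : R := \sum_e `|r e|.
have k0 e : 0 <= r e + C.
  have := ler_norm (- r e); rewrite normrN /C (bigD1 e)//=.
  suff : 0 <= \sum_(i | i != e) `|r i| by lra.
  by apply: sumr_ge0 => i _; exact: normr_ge0.
pose n : R := #|edge G|%:R.
have n0 : 0 < n by rewrite ltr0n; exact: edge_card_gt0.
(* Each edge gets mass [n^-1], so the factor [n] makes its flow [r e + C]; the constant [C] makes
   the speeds nonnegative and pairs to 0 with every cochain. *)
pose q e : {nonneg R} := NngNum (mulr_ge0 (ltW n0) (k0 e)).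
have m0 (e : edge G) : 0 <= n^-1 by rewrite invr_ge0 ltW.
have m1 : \sum_(e : edge G) n^-1 = 1.
  by rewrite sumr_const -[RHS](mulVf (lt0r_neq0 n0)) -mulr_natr.
have [mu muE] := weighted_probability (fun e => tpoint e (q e) : borel_tangent R G) m0 m1.
have muE' A : measurable A -> _ := fun _ => muE A.
have formE (w : cochain1 R G) : integral_form w mu = pairing w h.
  rewrite (integral_form_weighted m0 muE') /pairing -/r.
  transitivity (\sum_e (r e * w e) + C * \sum_e w e).
    rewrite mulr_sumr -big_split/=; apply: eq_bigr => e _.
    by rewrite mulrA mulrA mulVf ?lt0r_neq0// mul1r; ring.
  by rewrite sum_cochain1 mulr0 addr0.
exists mu, (\sum_e n^-1 * lagrangian_edge H e (q e)%:num); split.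
- split; first exact: finite_first_moment_weighted m0 muE'.
  by move=> f; rewrite formE homology_pairing.
- by apply: pairing_separates => w; exact: formE.
- exact: (action_weighted m0 muE' HH).
Qed.

End MatherTheory.

(** * Mather measures *)

Section MainTheorem.
Variables (R : realType) (G : graph) (H : edge G -> R -> R).
Hypotheses (Gconn : connected_graph G) (Gloop : loopless G) (HH : hamiltonian H).

Lemma calibrated_weighted (v : cochain1 R G) a (I : finType) (m : I -> R)
    (e : I -> edge G) (q : I -> {nonneg R}) (mu : borel_probability R G) :
  (forall i, 0 <= m i) -> \sum_i m i = 1 ->
  (forall A, measurable A ->
    (mu A = \sum_i (m i)%:E * \d_(tpoint (e i) (q i) : borel_tangent R G) A)%E) ->
  (forall i, H (e i) (v (e i)) = a /\ derive1 (H (e i)) (v (e i)) = (q i)%:num) ->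
  twisted_action H v mu = (- a)%:E /\
  exists2 b, action H mu = b%:E & pairing v (rho mu) - b = a.
Proof.
move=> m0 m1 muE cal.
have Lq i : lagrangian_edge H (e i) (q i)%:num - (q i)%:num * v (e i) = - a.
  by have [va dv] := cal i; have := calibrated_action HH va; rewrite dv.
split.
  rewrite (twisted_action_weighted m0 muE v HH); congr EFin.
  by under eq_bigr do rewrite Lq; rewrite -mulr_suml m1 mul1r.
exists (\sum_i m i * lagrangian_edge H (e i) (q i)%:num).
  exact: (action_weighted m0 muE HH).
rewrite -/(integral_form v mu) (integral_form_weighted m0 muE) -sumrB.
rewrite -[RHS]mul1r -m1 mulr_suml; apply: eq_bigr => i _.
by have := Lq i; rewrite -mulrBr => Li; congr (_ * _); lra.
Qed.

(** The densities differ by an exact form, which integrates to 0 against a closed measure. *)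
Lemma twisted_action_cohomologous (w v : cochain1 R G) (I : finType) (m : I -> R)
    (e : I -> edge G) (q : I -> {nonneg R}) (mu : borel_probability R G) :
  (forall i, 0 <= m i) ->
  (forall A, measurable A ->
    (mu A = \sum_i (m i)%:E * \d_(tpoint (e i) (q i) : borel_tangent R G) A)%E) ->
  closed_measure mu -> \pi_(cohomology1 R G) w = \pi_(cohomology1 R G) v ->
  twisted_action H w mu = twisted_action H v mu.
Proof.
move=> m0 muE cl /cohomology_eq[f wf].
rewrite !(twisted_action_weighted m0 muE _ HH); congr EFin.
have fcl := (closed_weighted m0 muE).2 cl f.
rewrite -[LHS]addr0 -[X in _ + X]fcl -big_split/=; apply: eq_bigr => i _.
by rewrite wf; ring.
Qed.

(** A Dirac mass written as a sum of one term, in the form that the results on weighted points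
    expect. *)
Lemma rest_measure (e : edge G) : exists mu : borel_probability R G,
  forall A, measurable A -> (mu A =
    \sum_(i < 1) (1 : R)%:E * \d_(tpoint e 0%:nng%R : borel_tangent R G) A)%E.
Proof.
by exists (dirac (tpoint e 0%:nng : borel_tangent R G)) => A _; rewrite big_ord1 mul1e.
Qed.

Lemma circuit_measure_exists N (z : N.-tuple (edge G)) (Q : 'I_N -> {nonneg R}) :
  is_circuit z -> (forall i, (Q i)%:num != 0) ->
  exists mu : borel_probability R G, forall A, measurable A -> (mu A =
    \sum_i (circuit_weight Q i)%:E * \d_(tpoint (tnth z i) (Q i) : borel_tangent R G) A)%E.
Proof.
move=> zC Q0.
have [mu muE] := weighted_probability (fun i => tpoint (tnth z i) (Q i) : borel_tangent R G)
  (circuit_weight_ge0 zC Q0) (circuit_weight_sum zC Q0).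
by exists mu.
Qed.

Lemma calibrated_measure_exists (v : cochain1 R G) a :
  (forall e, H e (v e) <= a) ->
  (forall b (u : cochain0 R G),
    (forall e, H e (u (term e) - u (orig e) + v e) <= b) -> a <= b) ->
  exists (mu : borel_probability R G) b,
    [/\ closed_measure mu, action H mu = b%:E & pairing v (rho mu) - b = a].
Proof.
move=> va a_crit; case: (critical_cycle HH va a_crit) => [[e [ve dve]]|[z [zC zv]]].
  have [mu muE] := rest_measure e.
  have m0 (i : 'I_1) : 0 <= (1 : R) by [].
  have m1 : \sum_(i < 1) (1 : R) = 1 by rewrite big_ord1.
  have [i|_ [b mub pb]] := calibrated_weighted (v := v) (a := a) m0 m1 muE.
    by rewrite ve dve.
  exists mu, b; split=> //; apply/(closed_weighted m0 muE) => f.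
  by rewrite big_ord1 mulr0 mul0r.
(* The absolute value only supplies a nonnegative type; the derivatives on [z] are positive. *)
pose Q (i : 'I_(size z)) : {nonneg R} :=
    NngNum (normr_ge0 (derive1 (H (tnth (in_tuple z) i)) (v (tnth (in_tuple z) i)))).
have zt i : tnth (in_tuple z) i \in z by exact: mem_tnth.
have QE i : (Q i)%:num = derive1 (H (tnth (in_tuple z) i)) (v (tnth (in_tuple z) i)).
  by rewrite /= gtr0_norm//; case: (zv _ (zt i)).
have Q0 i : (Q i)%:num != 0 by rewrite QE gt_eqF//; case: (zv _ (zt i)).
have [mu muE] := circuit_measure_exists (z := in_tuple z) zC Q0.
have [i|_ [b mub pb]] := calibrated_weighted (v := v) (a := a)
    (circuit_weight_ge0 (z := in_tuple z) zC Q0) (circuit_weight_sum (z := in_tuple z) zC Q0) muE.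
  by rewrite QE; case: (zv _ (zt i)).
by exists mu, b; split=> //; exact: (circuit_measure_closed (z := in_tuple z) zC Q0 muE).
Qed.

(** Integrating the Fenchel bound gives [beta h >= pairing v h - a], hence [alpha] is at most [a];
    the rotation vector of a calibrated measure attains [a]. *)
Lemma critical_value_alpha (w : cochain1 R G) :
  critical_value (twist H w) = alpha H (\pi_(cohomology1 R G) w).
Proof.
have [v [vw va a_crit]] := cohomologous_subsolution Gconn HH w.
set a := critical_value _ in va a_crit *.
have beta_lb h : lbound [set b | exists mu, [/\ closed_measure mu, rho mu = h
    & action H mu = b%:E]] (pairing v h - a).
  by move=> b [mu [cl <- mub]]; exact: action_ge cl mub.
have alpha_ub : ubound [set class_pairing (\pi_(cohomology1 R G) w) h - beta H h | h in @homology1 R G] a.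
  move=> _ [h hh <-]; rewrite -vw class_pairing_eq//.
  suff : pairing v h - a <= beta H h by lra.
  apply: lb_le_inf (@beta_lb h); have [mu [b mub]] := homology_action HH hh.
  by exists b, mu.
have [mu [b [cl mub pb]]] := calibrated_measure_exists va a_crit.
have hmu := closed_measure_homology cl.
apply/le_anti/andP; split; last first.
  apply: ge_sup => //.
  by exists (class_pairing (\pi_(cohomology1 R G) w) (rho mu) - beta H (rho mu)), (rho mu).
have bb : beta H (rho mu) <= b.
  by apply: ge_inf; [exists (pairing v (rho mu) - a)|exists mu].
apply: le_trans (_ : class_pairing (\pi_(cohomology1 R G) w) (rho mu) - beta H (rho mu) <= _).
  by rewrite -vw class_pairing_eq//; lra.
apply: sup_upper_bound; last by exists (rho mu).
by split; [exists (class_pairing (\pi_(cohomology1 R G) w) (rho mu) - beta H (rho mu)), (rho mu)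
  |exists a].
Qed.

Lemma sigma_calibrated (v : cochain1 R G) a e : H e (v e) = a ->
  0 <= derive1 (H e) (v e) -> sigma H e a = v e.
Proof. by move=> <-; exact: sigma_eq. Qed.

(* mu is carried by the points where the Fenchel inequality for v is an
   equality, of which there is one per edge. *)
Lemma calibrated_finite_support (v : cochain1 R G) a (mu : borel_probability R G) :
  (forall e, H e (v e) <= a) -> twisted_action H v mu = (- a)%:E ->
  exists (m : edge G -> R) (q : edge G -> {nonneg R}),
    [/\ forall e, 0 <= m e, forall A, measurable A ->
          (mu A = \sum_e (m e)%:E * \d_(tpoint e (q e) : borel_tangent R G) A)%E
      & forall e, 0 < m e -> H e (v e) = a /\ derive1 (H e) (v e) = (q e)%:num].
Proof.
move=> va muv.
pose q e : {nonneg R} := NngNum (normr_ge0 (derive1 (H e) (v e))).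
pose pt e : borel_tangent R G := tpoint e (q e).
(* At speed 0 an edge and its reverse give the same point; the last condition keeps only the edge of
   the canonical representative. *)
pose P : {pred edge G} := [pred e | [&& H e (v e) == a, 0 <= derive1 (H e) (v e)
  & (repr (tpoint e (q e))).1 == e]].
have mL : measurable_fun setT (twisted_lagrangian H v : borel_tangent R G -> R).
  apply: measurable_funB; first exact: measurable_lagrangian.
  exact: measurable_form_density.
pose F (x : borel_tangent R G) : R := twisted_lagrangian H v x + a.
have mF : measurable_fun setT F by apply: measurable_funD.
have F0 x : 0 <= F x by have := twisted_lagrangian_ge HH va x; rewrite /F; lra.
have Lint := integrable_fin_integral mL muv.
(* The nonnegative Fenchel gap [F] has integral 0, so it vanishes almost everywhere. *)
have intF : (\int[mu]_x `|(F x)%:E| = 0)%E.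
  under eq_integral => x _ do rewrite abse_EFin (ger0_norm (F0 x)) EFinD.
  rewrite (integralD measurableT Lint (finite_measure_integrable_cst mu a measurableT)).
  have -> := integral_cst mu measurableT a%:E.
  rewrite [X in (_ + _ * X)%E](@probability_setT _ _ _ mu) mule1.
  rewrite [X in (X + _)%E](_ : _ = (- a)%:E)//.
  by rewrite -EFinD addNr.
have /ae_eq_integral_abs : measurable_fun setT (EFin \o F) by exact/measurable_EFinP.
move=> /(_ mu measurableT) [/(_ intF) [N [mN muN NF]] _].
have SN : (~` [set pt e | e in [set` P]]) `<=` N.
  move=> x xS; apply: NF => /= /(_ I) [Fx]; apply: xS.
  have xE := tpoint_repr x.
  have [|ve dve] := @twisted_lagrangian_calibrated _ _ _ HH v a va (repr x).1 (repr x).2.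
    by rewrite xE; move: Fx; rewrite /F; lra.
  have qx : q (repr x).1 = (repr x).2.
    by apply/val_inj => /=; rewrite dve ger0_norm.
  exists (repr x).1; last by rewrite /pt qx.
  by rewrite /= inE ve eqxx dve ge0 qx xE eqxx.
have mS : measurable (~` [set pt e | e in [set` P]]).
  apply: measurableC; rewrite -bigcup_imset1; apply: fin_bigcup_measurable => // e _.
  exact: measurable_tangent_set1.
have muS := subset_measure0 mS mN SN muN.
have ptinj : {in P &, injective pt}.
  move=> e f /and3P[_ _ /eqP re] /and3P[_ _ /eqP rf] ef.
  by rewrite -re -rf -/(pt e) ef.
have muE := concentrated_weighted ptinj (fun e => measurable_tangent_set1 (pt e)) muS.
exists (fun e => if e \in P then fine (mu [set pt e]) else 0), q; split=> // e.
  by case: ifP => // _; rewrite fine_ge0.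
case: ifP => [/and3P[/eqP ve dve _] _|_]; last by rewrite ltxx.
by rewrite ve /= ger0_norm.
Qed.

Lemma irreducible_mather_circuit (w : cochain1 R G) (mu : borel_probability R G) :
  irreducible_measure mu -> mather_measures H (\pi_(cohomology1 R G) w) mu ->
  exists (N : nat) (z : N.-tuple (edge G)), [/\ is_circuit z, supported_on z mu
    & sigma_path H w z (alpha H (\pi_(cohomology1 R G) w)) = 0].
Proof.
move=> muirr [mucl muw]; rewrite -critical_value_alpha in muw *.
have [v [vw va a_crit]] := cohomologous_subsolution Gconn HH w.
set a := critical_value _ in muw va a_crit *.
have [m [q [m0 muE mcal]]] := calibrated_finite_support va (muw v vw).
have m1 : \sum_e m e = 1.
  apply: EFin_inj; rewrite -sumEFin -[RHS](@probability_setT _ _ _ mu) muE//.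
  by apply: eq_bigr => i _; rewrite diracT mule1.
have sigma0 (z : seq (edge G)) : is_circuit z ->
    (forall e, e \in z -> sigma H e a = v e) -> sigma_path H w z a = 0.
  move=> zC zs; rewrite -(sigma_path_cohomologous H a vw)// /sigma_path.
  by rewrite big1_seq// => e /andP[_ /zs ->]; rewrite subrr.
have [/existsP[e /andP[me /eqP qe]]|norest] :=
    boolP [exists e, (0 < m e) && ((q e)%:num == 0)].
  (* A Dirac mass at rest is closed, so irreducibility makes [mu] equal to it. *)
  have [ve dve] := mcal e me; rewrite qe in dve.
  have muD A : measurable A -> mu A = \d_(tpoint e (q e) : borel_tangent R G) A.
    move=> mA; rewrite (irreducible_weighted (n := fun f => (f == e)%:R) m0 muE)//.
    - rewrite (bigD1 e)//= eqxx mul1e big1 ?adde0// => f fe.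
      by rewrite (negPf fe) mul0e.
    - by rewrite (bigD1 e)//= eqxx big1 ?addr0// => f /negPf ->.
    - by move=> f; case: eqP => [->//|_]; rewrite ltxx.
    - by move=> f; rewrite big1// => i _; case: eqP => [->|_]; rewrite ?qe ?mulr0 !mul0r.
  (* The support is [e] followed by its reverse, whose ends are distinct because there are no
     loops. *)
  have zC : is_circuit [:: e; rev_edge e].
    rewrite /is_circuit /is_cycle /= /consecutive /= /term rev_edgeK !eqxx /=.
    by rewrite inE andbT; apply/eqP => /esym; exact: Gloop.
  exists 2%N, [tuple of [:: e; rev_edge e]]; split=> //; last first.
    apply: sigma0 => // f; rewrite !inE => /orP[]/eqP ->.
      by apply: sigma_calibrated; rewrite // dve.
    apply: sigma_calibrated; rewrite cochain1_rev ?derive1_rev ?dve ?oppr0//.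
    by rewrite (hamiltonian_rev HH) rev_edgeK opprK.
  split=> //; exists (fun=> 0%:nng), (fun=> 1); split.
    split=> //.
    - by rewrite /is_path /= /consecutive /= /term eqxx.
    - by move=> i; rewrite eqxx.
    - move=> _ [[|[|//]] ?] [[|[|//]] ?] //= _ _.
      by rewrite !(tnth_nth e) /= /term rev_edgeK.
    - by move=> [[|[|//]] ?] [[|[|//]] ?] //= _ _; rewrite !(tnth_nth e) /= eqxx.
    - by move=> i _; rewrite eqxx.
  move=> A mA; rewrite muD// /occupation_measure /total_time !big_ord_recl !big_ord0.
  rewrite addr0 adde0 !mul1e !(tnth_nth e) /=.
  have q0 : q e = 0%:nng by apply/val_inj.
  (* The two entries, with half of the time each, are one point of the tangent bundle. *)
  have -> : tpoint (rev_edge e) 0%:nng = tpoint e 0%:nng :> tangent R G.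
    by apply/eqP; rewrite tpoint_eq0// eqxx orbT.
  by rewrite q0 diracE -EFinD -EFinM; congr EFin; field.
have q0 e : 0 < m e -> 0 < (q e)%:num.
  move=> me; rewrite lt_def ge0 andbT; apply: contraNN norest => qe.
  by apply/existsP; exists e; rewrite me qe.
(* The edges that carry flow; conservation yields a circuit among them. *)
pose P := [pred e | 0 < m e * (q e)%:num].
have Pm e : P e -> 0 < m e.
  move=> /= Pe; rewrite lt_def m0 andbT; apply/eqP => me.
  by move: Pe; rewrite me mul0r ltxx.
have [e Pe] : exists e, P e.
  apply: contrapT => noP; move: m1; rewrite big1 => [/esym/eqP|e _]; first by rewrite oner_eq0.
  have := m0 e; rewrite le_eqVlt => /predU1P[//|me].
  by exfalso; apply: noP; exists e; rewrite /= mulr_gt0// q0.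
have kcl := (closed_weighted m0 muE).2 mucl.
have [z [zC /allP zP]] := connect_circuit Pe (circulation_connect (fun=> erefl)
  (fun e => mulr_ge0 (m0 e) (ge0 (q e))) kcl Pe).
pose Q (i : 'I_(size z)) := q (tnth (in_tuple z) i).
have Q0 i : (Q i)%:num != 0 by rewrite gt_eqF// q0// Pm// zP// mem_tnth.
pose T : R := \sum_i (Q i)%:num^-1.
(* The circuit measure as weights on all edges, comparable with [m] on the same points. *)
pose n e := if e \in z then T^-1 * (q e)%:num^-1 else 0.
have to_tuple (V : nmodType) (F : edge G -> V) :
    \sum_e (if e \in z then F e else 0) = \sum_i F (tnth (in_tuple z) i).
  by rewrite -big_mkcond -big_uniq ?circuit_uniq//= big_tnth.
have n0 e' : 0 <= n e'.
  rewrite /n; case: ifP => // _; rewrite mulr_ge0 ?invr_ge0//.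
  by apply: sumr_ge0 => i _; rewrite invr_ge0.
have muz A : measurable A -> (mu A = \sum_i (circuit_weight Q i)%:E *
    \d_(tpoint (tnth (in_tuple z) i) (Q i) : borel_tangent R G) A)%E.
  move=> mA; rewrite (irreducible_weighted m0 muE muirr n0)//.
  - rewrite -(to_tuple _ (fun e => ((T^-1 * (q e)%:num^-1)%:E *
      \d_(tpoint e (q e) : borel_tangent R G) A)%E)); apply: eq_bigr => f _.
    by rewrite /n; case: ifP => // _; rewrite mul0e.
  - rewrite to_tuple; exact: (circuit_weight_sum (z := in_tuple z) zC Q0).
  - by move=> f; rewrite /n; case: ifP => [/zP/Pm//|]; rewrite ltxx.
  - move=> f; have := circuit_weight_closed (z := in_tuple z) zC Q0 f.
    rewrite -(to_tuple _ (fun e => T^-1 * (q e)%:num^-1 * (q e)%:num * (f (term e) - f (orig e)))) => fE.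
    rewrite -[RHS]fE; apply: eq_bigr => g _.
    by rewrite /n; case: ifP => // _; rewrite !mul0r.
exists (size z), (in_tuple z); split=> //.
  exact: (circuit_measure_supported (z := in_tuple z) zC Q0 muz).
apply: sigma0 => // f /zP/Pm mf; have [vf dvf] := mcal f mf.
by apply: sigma_calibrated; rewrite // dvf.
Qed.

Lemma circuit_mather_measure (c : cohomology1 R G) (w : cochain1 R G) N (z : N.-tuple (edge G)) :
  \pi_(cohomology1 R G) w = c -> is_circuit z -> sigma_path H w z (alpha H c) = 0 ->
  (forall i, aubry_speed H c (tnth z i) != 0) ->
  exists mu : borel_probability R G,
    [/\ irreducible_measure mu, mather_measures H c mu & supported_on z mu].
Proof.
move=> wc zC sz zQ; pose r : cochain1 R G := repr c.
have rc : \pi_(cohomology1 R G) r = c by rewrite reprK.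
have aE : class_critical_value H c = alpha H c.
  by rewrite /class_critical_value critical_value_alpha rc.
have us : subsolution (twist H r) (alpha H c) (critical_subsolution H c).
  rewrite -aE; apply: (@xgetPex _ 0
    [set u | subsolution (twist H r) (class_critical_value H c) u]).
  exact: critical_subsolution_exists.
set a := alpha H c in us sz aE *; set u := critical_subsolution H c in us *.
pose v := r + coboundary u.
have vE e : v e = r e + (u (term e) - u (orig e)) by rewrite /= !ffunE.
have vc : \pi_(cohomology1 R G) v = c.
  by rewrite -rc; apply/cohomology_eq; exists u => e; rewrite vE.
have va e : H e (v e) <= a by rewrite vE addrC; move/subsolutionP: us; exact.
have dv i : derive1 (H (tnth z i)) (v (tnth z i)) != 0.
  (* A nonzero speed excludes the default value 0 taken off the Aubry set, so it is the derivative
     at [v]. *)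
  have := zQ i; rewrite /aubry_speed; case: ifP => _; last by rewrite eqxx.
  by rewrite derive1_twist ffunE vE addrC.
have vs e : v e <= sigma H e a by exact: le_sigma.
have svz : \sum_i (sigma H (tnth z i) a - v (tnth z i)) = 0.
  transitivity (sigma_path H w z a); last exact: sz.
  rewrite (sigma_path_cohomologous H a (v := v) (w := w))// ?vc//.
  by rewrite /sigma_path big_tuple.
(* The terms of [svz] are nonnegative and sum to 0, so each vanishes: every edge of the circuit is
   tight, with nonnegative speed. *)
have sv i : v (tnth z i) = sigma H (tnth z i) a.
  move/eqP: svz; rewrite psumr_eq0 => [/allP/(_ i (mem_index_enum i))|j _].
    by rewrite /= subr_eq0 => /eqP.
  by rewrite subr_ge0.
have ma e : min_level H e <= a by exact: le_trans (minimizer_le HH e (v e)) (va e).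
pose Q i : {nonneg R} :=
    NngNum (normr_ge0 (derive1 (H (tnth z i)) (v (tnth z i)))).
have cal i : H (tnth z i) (v (tnth z i)) = a /\
    derive1 (H (tnth z i)) (v (tnth z i)) = (Q i)%:num.
  have [_ sa] := sigma_spec HH (ma (tnth z i)).
  by rewrite /= sv sa ger0_norm// derive1_sigma_ge0.
have Q0 i : (Q i)%:num != 0 by rewrite -(cal i).2.
have [mu muE] := circuit_measure_exists zC Q0.
have w0 := circuit_weight_ge0 zC Q0; have w1 := circuit_weight_sum zC Q0.
have mucl := circuit_measure_closed zC Q0 muE.
exists mu; split; last exact: (circuit_measure_supported zC Q0 muE).
  exact: (circuit_measure_irreducible zC Q0 muE).
split=> // w' w'c; rewrite (twisted_action_cohomologous w0 muE mucl (v := v)) ?vc//.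
by case: (calibrated_weighted w0 w1 muE cal).
Qed.

End MainTheorem.

Theorem theorem8p1 (R : realType) (G : graph) (Gconn : connected_graph G)
    (Gloop : loopless G) (H : edge G -> R -> R) (HH : hamiltonian H)
    (c : cohomology1 R G) (w : cochain1 R G)
    (wc : \pi_(cohomology1 R G) w = c) :
  [/\ critical_value (twist H w) = alpha H c,
      forall mu : borel_probability R G,
        irreducible_measure mu -> mather_measures H c mu ->
        exists (N : nat) (z : N.-tuple (edge G)),
          [/\ is_circuit z, supported_on z mu
            & sigma_path H w z (alpha H c) = 0]
    & forall (N : nat) (z : N.-tuple (edge G)),
        is_circuit z -> sigma_path H w z (alpha H c) = 0 ->
        (forall i : 'I_N, aubry_speed H c (tnth z i) != 0) ->
        exists mu : borel_probability R G,
          [/\ irreducible_measure mu,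
              exists c' : cohomology1 R G, mather_measures H c' mu
            & supported_on z mu]].
Proof.
split=> [|mu muirr|N z zC sz zQ].
- by rewrite -wc; exact: critical_value_alpha.
- by rewrite -wc; exact: irreducible_mather_circuit.
- have [mu [muirr muc muz]] := circuit_mather_measure Gconn HH wc zC sz zQ.
  by exists mu; split=> //; exists c.
Qed.
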